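(* Let $E$ and $F$ be countable directed graphs satisfying Conditions (L) and (T) and having no degenerate vertices. Then the following are equivalent: (1) $\mathcal{G}_E\cong\mathcal{G}_F$ as topological groupoids; (2) $\llbracket\mathcal{G}_E\rrbracket\cong\llbracket\mathcal{G}_F\rrbracket$ as abstract groups.
   Context: A graph $E=(E^0,E^1,r,s)$ has vertices $E^0$, edges $E^1$ and range/source maps $r,s\colon E^1\to E^0$. A finite path is $\mu=e_1\cdots e_n$ with $r(e_i)=s(e_{i+1})$, $|\mu|=n$, $s(\mu)=s(e_1)$, $r(\mu)=r(e_n)$; vertices are paths of length $0$; $E^*$ is the set of finite paths; $vE^*w$ denotes paths from $v$ to $w$ and $vE^1, E^1v$ edges with source, resp. range, $v$. A vertex $v$ is a sink if $vE^1=\emptyset$, a source if $E^1v=\emptyset$, an infinite emitter if $vE^1$ is infinite; singular vertices are sinks and infinite emitters. A cycle is a path $\mu$ with $|\mu|\ge1$ and $r(\mu)=s(\mu)$; a loop is a cycle of length 1; an exit of $\mu=e_1\cdots e_n$ is an edge $e$ with $s(e)=s(e_i)$, $e\neq e_i$ for some $i$. Condition (L): every cycle has an exit. Condition (T): for every $v\in E^0$ there is $w\in E^0$ with $|vE^*w|\ge 2$. A vertex $v$ is degenerate if one of: (1) $E^1v=\{e\}$ with $e$ a loop; (2) $E^1v=\{e,f\}$ with $e$ a loop and $s(f)$ a source; (3) there is $w\neq v$ with $E^1v=\{e\}=wE^1v$ and $E^1w=\{f\}=vE^1w$; (4) $vE^1$ is infinite and $E^1v=\emptyset$; (5) $v$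 is singular and $E^1v=\{f\}$ with $s(f)$ a source; (6) $vE^1=E^1v=\emptyset$. Infinite paths $x=e_1e_2\cdots$ ($r(e_i)=s(e_{i+1})$) form $E^\infty$, with $|x|=\infty$. The boundary path space is $\partial E=E^\infty\cup\{\mu\in E^*: r(\mu)\text{ singular}\}$, topologized by the basis $Z(\mu\setminus F)=Z(\mu)\setminus\bigcup_{e\in F}Z(\mu e)$, where $Z(\mu)=\{\mu x: x\in\partial E, s(x)=r(\mu)\}$ and $F\subseteq r(\mu)E^1$ finite. Let $\partial E^{\ge n}=\{x\in\partial E: |x|\ge n\}$ and $\sigma_E\colon\partial E^{\ge1}\to\partial E$ delete the first edge ($\sigma_E(e)=r(e)$ for $e\in\partial E$ of length 1). The graph groupoid is $\mathcal{G}_E=\{(x,m-n,y): m,n\ge0, x\in\partial E^{\ge m}, y\in\partial E^{\ge n}, \sigma_E^m(x)=\sigma_E^n(y)\}$ with $(x,k,y)(y,l,z)=(x,k+l,z)$, $(x,k,y)^{-1}=(y,-k,x)$, unit space identified with $\partial E$ via $(x,0,x)\leftrightarrow x$, and topology generated by sets $\{(x,m-n,y): x\in U,y\in V,\sigma_E^m(x)=\sigma_E^n(y)\}$ for open $U\subseteq\partial E^{\ge m}$, $V\subseteq\partial E^{\ge n}$ with $\sigma_E^m|_U,\sigma_E^n|_V$ injective and $\sigma_E^m(U)=\sigma_E^n(V)$. It is an ample Hausdorff étale groupoid, effective exactly when $E$ satisfies (L). For an effective ample groupoid $\mathcal{G}$, $\llbracket\mathcal{G}\rrbracket$ is the group of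 homeomorphisms $\pi_U=r|_U\circ(s|_U)^{-1}$ of $\mathcal{G}^{(0)}$, for $U$ an open bisection (open set on which $s,r$ are injective) with $s(U)=r(U)=\mathcal{G}^{(0)}$, such that the support (closure of the set of moved points) of $\pi_U$ is compact. *)

(* Defs.v *)
From Stdlib Require List.
From mathcomp Require Import all_boot all_algebra.
Set Implicit Arguments. Unset Strict Implicit. Unset Printing Implicit Defensive.
Import GRing.Theory.

Definition gen_open (T : Type) (sb : (T -> Prop) -> Prop) (O : T -> Prop) : Prop :=
  forall x, O x -> exists Bs : seq (T -> Prop),
    (forall B, List.In B Bs -> sb B) /\ (forall B, List.In B Bs -> B x) /\
    (forall y, (forall B, List.In B Bs -> B y) -> O y).

Definition continuous_wrt (T1 T2 : Type) (op1 : (T1 -> Prop) -> Prop)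
  (op2 : (T2 -> Prop) -> Prop) (f : T1 -> T2) : Prop :=
  forall O, op2 O -> op1 (fun x => O (f x)).

Definition closure_wrt (T : Type) (op : (T -> Prop) -> Prop) (A : T -> Prop) : T -> Prop :=
  fun x => forall O, op O -> O x -> exists y, O y /\ A y.

Definition compact_wrt (T : Type) (op : (T -> Prop) -> Prop) (K : T -> Prop) : Prop :=
  forall (I : Type) (O : I -> T -> Prop), (forall i, op (O i)) ->
    (forall x, K x -> exists i, O i x) ->
    exists s : seq I, forall x, K x -> exists i, List.In i s /\ O i x.

Record graph := Graph {
  vtx : countType;
  edg : countType;
  rg : edg -> vtx;
  sc : edg -> vtx
}.

Section Graph.
Variable E : graph.
Local Notation V := (vtx E).
Local Notation Ed := (edg E).
Local Notation r := (@rg E).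
Local Notation s := (@sc E).

Fixpoint is_path (v : V) (l : seq Ed) : Prop :=
  match l with
  | [::] => True
  | e :: l' => s e = v /\ is_path (r e) l'
  end.

Fixpoint prange (v : V) (l : seq Ed) : V :=
  match l with
  | [::] => v
  | e :: l' => prange (r e) l'
  end.

Definition is_sink (v : V) : Prop := forall e : Ed, s e <> v.
Definition is_source (v : V) : Prop := forall e : Ed, r e <> v.
Definition inf_emitter (v : V) : Prop :=
  ~ (exists L : seq Ed, forall e, s e = v -> e \in L).
Definition singular (v : V) : Prop := is_sink v \/ inf_emitter v.

Definition condL : Prop :=
  forall (v : V) (l : seq Ed), is_path v l -> size l >= 1 -> prange v l = v ->
    exists (e : Ed) (i : nat), i < size l /\
      s e = s (nth e l i) /\ e <> nth e l i.

Definition condT : Prop :=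
  forall v : V, exists (w : V) (l1 l2 : seq Ed),
    is_path v l1 /\ prange v l1 = w /\ is_path v l2 /\ prange v l2 = w /\ l1 <> l2.

Definition degenerate (v : V) : Prop :=
  (* (1) *) (exists e, (forall g, r g = v <-> g = e) /\ s e = r e) \/
  (* (2) *) (exists e f, (forall g, r g = v <-> g = e \/ g = f) /\ s e = r e /\
                         is_source (s f)) \/
  (* (3) *) (exists (w : V) e f, w <> v /\
               (forall g, r g = v <-> g = e) /\ (forall g, (s g = w /\ r g = v) <-> g = e) /\
               (forall g, r g = w <-> g = f) /\ (forall g, (s g = v /\ r g = w) <-> g = f)) \/
  (* (4) *) (inf_emitter v /\ is_source v) \/
  (* (5) *) (singular v /\ exists f, (forall g, r g = v <-> g = f) /\ is_source (s f)) \/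
  (* (6) *) (is_sink v /\ is_source v).

Definition no_degenerate : Prop := forall v : V, ~ degenerate v.

Inductive bpath := Fin of V & seq Ed | Inf of (nat -> Ed).

Definition bvalid (x : bpath) : Prop :=
  match x with
  | Fin v l => is_path v l /\ singular (prange v l)
  | Inf f => forall i, r (f i) = s (f i.+1)
  end.

Definition bE := {x : bpath | bvalid x}.

Definition bsrc (x : bpath) : V :=
  match x with Fin v _ => v | Inf f => s (f 0) end.

Definition len_ge (x : bpath) (m : nat) : Prop :=
  match x with Fin _ l => m <= size l | Inf _ => True end.

Definition shift (x : bpath) : bpath :=
  match x with
  | Fin v [::] => Fin v [::]
  | Fin _ (e :: l) => Fin (r e) l
  | Inf f => Inf (fun i => f i.+1)
  end.

Definition in_Z (v : V) (l : seq Ed) (y : bpath) : Prop :=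
  bsrc y = v /\
  match y with
  | Fin _ l' => exists t, l' = l ++ t
  | Inf f => l = [seq f i | i <- iota 0 (size l)]
  end.

Definition Z_basic (B : bE -> Prop) : Prop :=
  exists (v : V) (l : seq Ed) (F : seq Ed),
    is_path v l /\ (forall e, e \in F -> s e = prange v l) /\
    forall y : bE, B y <-> (in_Z v l (proj1_sig y) /\
                            forall e, e \in F -> ~ in_Z v (rcons l e) (proj1_sig y)).

Definition bE_open : (bE -> Prop) -> Prop := gen_open Z_basic.

Record gtrip := GTrip { gx : bE; gk : int; gy : bE }.

Definition inG (t : gtrip) : Prop :=
  exists m n : nat, len_ge (proj1_sig (gx t)) m /\ len_ge (proj1_sig (gy t)) n /\
    iter m shift (proj1_sig (gx t)) = iter n shift (proj1_sig (gy t)) /\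
    gk t = (m%:Z - n%:Z)%R.

Definition grpd := {t : gtrip | inG t}.

Definition G_basic (S : grpd -> Prop) : Prop :=
  exists (m n : nat) (U W : bE -> Prop),
    bE_open U /\ bE_open W /\
    (forall x, U x -> len_ge (proj1_sig x) m) /\ (forall y, W y -> len_ge (proj1_sig y) n) /\
    (forall x1 x2, U x1 -> U x2 -> iter m shift (proj1_sig x1) = iter m shift (proj1_sig x2) -> x1 = x2) /\
    (forall y1 y2, W y1 -> W y2 -> iter n shift (proj1_sig y1) = iter n shift (proj1_sig y2) -> y1 = y2) /\
    (forall z, (exists x, U x /\ iter m shift (proj1_sig x) = z) <->
               (exists y, W y /\ iter n shift (proj1_sig y) = z)) /\
    forall g : grpd, S g <->
      (U (gx (proj1_sig g)) /\ W (gy (proj1_sig g)) /\ gk (proj1_sig g) = (m%:Z - n%:Z)%R /\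
       iter m shift (proj1_sig (gx (proj1_sig g))) = iter n shift (proj1_sig (gy (proj1_sig g)))).

Definition G_open : (grpd -> Prop) -> Prop := gen_open G_basic.

Definition gprod (a b c : grpd) : Prop :=
  gy (proj1_sig a) = gx (proj1_sig b) /\ gx (proj1_sig c) = gx (proj1_sig a) /\
  gk (proj1_sig c) = (gk (proj1_sig a) + gk (proj1_sig b))%R /\ gy (proj1_sig c) = gy (proj1_sig b).

(* open bisections with s(U) = r(U) = unit space (identified with dE) *)
Definition full_bisection (U : grpd -> Prop) : Prop :=
  G_open U /\
  (forall a b, U a -> U b -> gy (proj1_sig a) = gy (proj1_sig b) -> a = b) /\
  (forall a b, U a -> U b -> gx (proj1_sig a) = gx (proj1_sig b) -> a = b) /\
  (forall y, exists a, U a /\ gy (proj1_sig a) = y) /\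
  (forall x, exists a, U a /\ gx (proj1_sig a) = x).

Definition in_full_group (h : bE -> bE) : Prop :=
  exists U, full_bisection U /\
    (forall a, U a -> h (gy (proj1_sig a)) = gx (proj1_sig a)) /\
    compact_wrt bE_open (closure_wrt bE_open (fun x => h x <> x)).

Definition full_group := {h : bE -> bE | in_full_group h}.

End Graph.

Definition grpd_iso (E F : graph) : Prop :=
  exists (f : grpd E -> grpd F) (g : grpd F -> grpd E),
    cancel f g /\ cancel g f /\
    continuous_wrt (@G_open E) (@G_open F) f /\
    continuous_wrt (@G_open F) (@G_open E) g /\
    forall a b c, gprod a b c <-> gprod (f a) (f b) (f c).

Definition full_group_iso (E F : graph) : Prop :=
  exists phi : full_group E -> full_group F,
    bijective phi /\
    forall g h k : full_group E, proj1_sig k = proj1_sig g \o proj1_sig h ->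
      proj1_sig (phi k) = proj1_sig (phi g) \o proj1_sig (phi h).

(* Main.v *)
(** Only the implication from groups to groupoids is hard; it is a reconstruction of Rubin type.
    Write [mv g] for the set of points moved by [g].  For an involution [p] the elements [g] with
    [mv g] contained in [mv p] form the centralizer of a set of squares defined from [p] in the
    language of groups (Fremlin, Matui), so a group isomorphism preserves inclusion and
    disjointness of the sets [mv p] for involutions [p].  These sets are compact open, and as every
    groupoid orbit has at least three points (no degenerate vertices) their pairwise
    intersections form a basis of the boundary path space: points are recovered as consistent
    families of involutions, whence an equivariant homeomorphism.  Condition (T) puts three
    points of one orbit in every nonempty open set, which supplies enough small group elements.
    Finally every groupoid element is the germ of a full group element, and by Condition (L) a
    germ determines the groupoid element, so the homeomorphism extends to the groupoids. *)

Require Import Defs.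
From Stdlib Require Import Classical FunctionalExtensionality IndefiniteDescription.
From mathcomp Require Import all_boot all_algebra.
From mathcomp Require Import zify.
Set Implicit Arguments. Unset Strict Implicit. Unset Printing Implicit Defensive.

(** * Reconstruction of a space from a group acting on it *)

(** Involutions are singled out because their moved sets are clopen. An element whose germ at a
    fixed point has nonzero degree moves points arbitrarily close to that point, whereas for an
    involution this degree satisfies [k + k = 0]. Squares are taken because an element commuting
    with all small pieces of [p] can still act like [p] on some of the points moved by [p]; squaring
    erases this and leaves the behaviour outside visible. To see something there, the square of a
    small element must be nontrivial, so involutions do not suffice: hence three points of an orbit
    in each open set, on which two swaps compose to a 3-cycle. One involution cannot isolate a point
    [x]: it also moves a partner of [x], and a small open set may contain no other point of the
    orbit of [x]. Two involutions with different partners, kept apart by a clopen set, have only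
    points near [x] in common. A group isomorphism carries no integers, and a homeomorphism of the
    unit spaces says nothing of degrees; the degree of an image arrow is read off the germ of the
    image of a group element. *)

Record action := Action {
  pt : Type;
  aopen : (pt -> Prop) -> Prop;
  gr : Type;
  act : gr -> pt -> pt;
  amul : gr -> gr -> gr;
  aone : gr;
  ainv : gr -> gr;
  act_mul : forall g h x, act (amul g h) x = act g (act h x);
  act_one : forall x, act aone x = x;
  act_invK : forall g, cancel (act g) (act (ainv g));
  act_invKV : forall g, cancel (act (ainv g)) (act g);
  act_faithful : forall g h, act g =1 act h -> g = h;
  act_continuous : forall g, continuous_wrt aopen aopen (act g);
  aopenI : forall A B, aopen A -> aopen B -> aopen (fun x => A x /\ B x);
  aopen_local : forall A,
    (forall x, A x -> exists B, aopen B /\ B x /\ forall z, B z -> A z) -> aopen A;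
  separated : forall x y, x <> y ->
    exists A, aopen A /\ aopen (fun z => ~ A z) /\ A x /\ ~ A y;
  fixed_open : forall p, amul p p = aone -> aopen (fun x => act p x = x);
  moved_compact : forall p, amul p p = aone -> compact_wrt aopen (fun x => act p x <> x);
  restriction : forall p A, amul p p = aone -> aopen A -> aopen (fun z => ~ A z) ->
    (forall x, A x -> A (act p x)) ->
    exists q, (forall x, A x -> act q x = act p x) /\ (forall x, ~ A x -> act q x = x);
  local_nonsquare : forall A x, aopen A -> A x ->
    exists g y, (forall z, act g z <> z -> A z) /\ act g (act g y) <> y;
  local_involution : forall A x, aopen A -> A x ->
    exists p, amul p p = aone /\ p <> aone /\ (forall z, act p z <> z -> A z);
  involution_subbasis : forall A x, aopen A -> A x ->
    exists p q, amul p p = aone /\ amul q q = aone /\ act p x <> x /\ act q x <> x /\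
      forall z, act p z <> z -> act q z <> z -> A z
}.

(** * Formulas in the language of groups *)

Section GroupFormulas.
Variables (T : Type) (mul : T -> T -> T) (one : T).

Definition commutes a b := mul a b = mul b a.

(** By the last clause [g] commutes with its conjugates under the centralizer of [p]. Restrictions
    of [p] to invariant clopen sets have this property, while an involution moving a point fixed by
    [p] has conjugates that differ from it too freely. Inverses are expressed by [mul h h' = one],
    so only product and unit have to be transported. *)
Definition Uset p g := commutes g p /\ mul g g = one /\
  forall h h', mul h h' = one -> commutes h p -> commutes g (mul h (mul g h')).

Definition Vset p g := forall h, Uset p h -> commutes g h.

(* For an involution [p] of an [action], [Wset p] is the set of elements supported where [p]
   moves points (lemma [WsetE]); Fremlin's formula. *)
Definition Wset p g := forall h, Vset p h -> commutes g (mul h h).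

End GroupFormulas.

Section GroupFormulasIso.
Variables (T T' : Type) (mul : T -> T -> T) (one : T) (mul' : T' -> T' -> T') (one' : T').
Variable f : T -> T'.
Hypotheses (f_bij : bijective f) (fM : forall a b, f (mul a b) = mul' (f a) (f b)).
Hypothesis f1 : f one = one'.

Lemma commutes_iso a b : commutes mul a b <-> commutes mul' (f a) (f b).
Proof.
by rewrite /commutes -!fM; split=> [->//|/(bij_inj f_bij)].
Qed.

Lemma eq1_iso a : a = one <-> f a = one'.
Proof. by rewrite -f1; split=> [->//|/(bij_inj f_bij)]. Qed.

Lemma Uset_iso p g : Uset mul one p g <-> Uset mul' one' (f p) (f g).
Proof.
case: (f_bij) => f' fK f'K.
rewrite /Uset -commutes_iso -fM -eq1_iso.
split=> -[gp [gg cg]]; do 2 split=> //.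
  move=> h h'; rewrite -(f'K h) -(f'K h') -!fM -commutes_iso -eq1_iso -commutes_iso.
  exact: cg.
by move=> h h' hh' hp; rewrite commutes_iso !fM; apply: cg;
  rewrite -?fM -?eq1_iso -?commutes_iso.
Qed.

Lemma Vset_iso p g : Vset mul one p g <-> Vset mul' one' (f p) (f g).
Proof.
case: (f_bij) => f' fK f'K.
split=> vg h.
  by rewrite -(f'K h) -Uset_iso -commutes_iso; apply: vg.
by rewrite Uset_iso commutes_iso; apply: vg.
Qed.

Lemma Wset_iso p g : Wset mul one p g <-> Wset mul' one' (f p) (f g).
Proof.
case: (f_bij) => f' fK f'K.
split=> wg h.
  by rewrite -(f'K h) -Vset_iso -fM -commutes_iso; apply: wg.
by rewrite Vset_iso commutes_iso fM; apply: wg.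
Qed.

End GroupFormulasIso.

(** * Moved sets expressed by commutation *)

Section Support.
Variable X : action.
Implicit Types (x y z : pt X) (g h p q : gr X).

Definition moves g x := act g x <> x.

Definition is_involution g := amul g g = aone X.

Lemma aopen_ext (A B : pt X -> Prop) : aopen A -> (forall x, A x <-> B x) -> aopen B.
Proof. by move=> oA AB; apply: aopen_local => x /AB Ax; exists A; split=> //; split=> // z /AB. Qed.

Lemma aopenU (A B : pt X -> Prop) : aopen A -> aopen B -> aopen (fun x => A x \/ B x).
Proof.
by move=> oA oB; apply: aopen_local => x [Ax|Bx]; [exists A|exists B];
  do 2 split=> //; auto.
Qed.

Lemma aopen_preim g (A : pt X -> Prop) : aopen A -> aopen (fun x => A (act g x)).
Proof. by move=> oA; apply: act_continuous oA. Qed.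

Lemma act_inj g : injective (act g).
Proof. exact: can_inj (act_invK g). Qed.

Lemma is_involutionE g : is_involution g <-> forall x, act g (act g x) = x.
Proof.
split=> [gg x|gK]; first by rewrite -act_mul gg act_one.
by apply: act_faithful => x; rewrite act_mul gK act_one.
Qed.

Lemma commutesE g h : commutes (@amul X) g h <-> forall x, act g (act h x) = act h (act g x).
Proof.
split=> [gh x|gh]; first by rewrite -!act_mul gh.
by apply: act_faithful => x; rewrite !act_mul gh.
Qed.

Lemma moves_act g x : moves g x <-> moves g (act g x).
Proof. by split=> gx e; apply: gx; [apply: act_inj e | rewrite e]. Qed.

Lemma moves_inv g x : moves (ainv g) x <-> moves g x.
Proof.
split=> gx e; apply: gx; last by rewrite -{1}e act_invKV.
by rewrite -{1}e act_invK.
Qed.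

Lemma commutes_moves g h x : commutes (@amul X) g h -> moves h (act g x) <-> moves h x.
Proof.
move=> /commutesE gh; split=> hx e; apply: hx; first by rewrite -gh e.
by apply: (@act_inj g); rewrite gh.
Qed.

Lemma disjoint_commutes g h : (forall x, moves g x -> ~ moves h x) -> commutes (@amul X) g h.
Proof.
move=> dis; apply/commutesE => x.
have [gx|/NNPP gx] := classic (moves g x).
  have /NNPP -> := dis _ gx.
  by have /moves_act/dis/NNPP-> := gx.
rewrite gx; have [hx|/NNPP->//] := classic (moves h x).
have [ghx|/NNPP//] := classic (moves g (act h x)).
by case: (dis _ ghx); rewrite -moves_act.
Qed.

Lemma displaced_neighbourhood p g x : is_involution p -> act p x = x -> moves g x ->
  exists A, aopen A /\ A x /\ (forall z, A z -> act p z = z) /\ (forall z, A z -> ~ A (act g z)).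
Proof.
move=> pp px gx.
have [B [oB [cB [Bx Bgx]]]] := separated (not_eq_sym gx).
exists (fun z => (B z /\ ~ B (act g z)) /\ act p z = z); split.
  apply: aopenI; last exact: fixed_open.
  by apply: aopenI => //; exact: aopen_preim cB.
by split=> //; split=> z; [case|move=> [[_ nB] _] [[]]].
Qed.

(** Otherwise take [h] supported in a small set [A] of fixed points of [p] that [g] displaces. At
    [y] the two products of [g] with its conjugate by [h] have the values [act (ainv h) y] and
    [act h y], which differ since the square of [h] moves [y]. *)
Lemma Uset_moves p g x : is_involution p -> Uset (@amul X) (aone X) p g -> moves g x -> moves p x.
Proof.
move=> pp [gp [/is_involutionE gg cg]] gx px.
have [A [oA [Ax [Ap Ag]]]] := displaced_neighbourhood pp px gx.
have [h [y [hA hhy]]] := local_nonsquare oA Ax.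
have hfix z : ~ A z -> act h z = z by move=> nA; apply: NNPP => /hA.
have vfix z : ~ A z -> act (ainv h) z = z.
  by move=> nA; apply: NNPP => /moves_inv/hA.
have hAA z : A z -> A (act (ainv h) z).
  move=> Az; have [/moves_act/moves_inv/hA//|/NNPP->//] := classic (moves (ainv h) z).
have /cg/(_ _)/commutesE : amul h (ainv h) = aone X.
  by apply: act_faithful => z; rewrite act_mul act_invKV act_one.
have hp : commutes (@amul X) h p by apply: disjoint_commutes => z /hA/Ap pz; rewrite /moves pz.
have Ay : A y by apply: hA => hy; apply: hhy; rewrite hy hy.
move=> /(_ hp y); rewrite !act_mul (hfix (act g _)) ?gg; last exact/Ag/hAA.
rewrite (vfix (act g _)) ?gg; last exact: Ag.
by move=> e; apply: hhy; rewrite -e act_invKV.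
Qed.

(** A restriction of [p] to an invariant clopen set lies in [Uset p]: its conjugates by elements
    commuting with [p] are again restrictions of [p], and any two restrictions of [p] commute. *)
Lemma involution_restriction p x y : is_involution p -> y <> x -> y <> act p x -> moves p x ->
  exists q, Uset (@amul X) (aone X) p q /\ moves q x /\ act q y = y.
Proof.
move=> pp yx ypx px; have /is_involutionE pK := pp.
have [B [oB [cB [Bx By]]]] := separated (not_eq_sym yx).
have [C [oC [cC [Cx Cpy]]]] : exists A, aopen A /\ aopen (fun z => ~ A z) /\ A x /\ ~ A (act p y).
  by apply: separated => e; apply: ypx; rewrite e pK.
(* The intersection of [B] and [C] contains [x] but neither [y] nor [act p y]; so adding its image
   under [p] makes it invariant without capturing [y]. *)
pose D z := (B z /\ C z) \/ (B (act p z) /\ C (act p z)).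
have oBC : aopen (fun z => B z /\ C z) by apply: aopenI.
have cBC : aopen (fun z => ~ (B z /\ C z)).
  by apply: (aopen_ext (aopenU cB cC)) => z; split=> [|/not_and_or//]; tauto.
have oD : aopen D by apply: aopenU => //; exact: aopen_preim oBC.
have cD : aopen (fun z => ~ D z).
  by apply: (aopen_ext (aopenI cBC (aopen_preim p cBC))) => z; rewrite /D; tauto.
have DA z : D z -> D (act p z) by rewrite /D pK; tauto.
have [q [qD qn]] := restriction pp oD cD DA.
have Dx : D x by left.
have nDy : ~ D y by rewrite /D; tauto.
exists q; split; last by rewrite /moves qD // qn.
have Dp z : D (act p z) -> D z by move/DA; rewrite pK.
split; [|split].
- apply/commutesE => z; have [Dz|nz] := classic (D z); first by rewrite !qD //; apply: DA.
  by rewrite !qn // => /Dp.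
- apply/is_involutionE => z; have [Dz|nz] := classic (D z); last by rewrite !qn.
  by rewrite !qD ?pK //; apply: DA.
move=> h h' hh' /commutesE hp; apply/commutesE => z; rewrite !act_mul.
have hK w : act h (act h' w) = w by rewrite -act_mul hh' act_one.
have h'p w : act h' (act p w) = act p (act h' w) by apply: (@act_inj h); rewrite hp !hK.
have qp w : D w -> act q (act p w) = w by move=> Dw; rewrite qD ?pK //; apply: DA.
have qn' w : ~ D w -> act q (act p w) = act p w by move=> nw; apply: qn => /Dp.
have [D'|n'] := classic (D (act h' z)).
  rewrite (qD (act h' z)) // hp hK; have [Dz|nz] := classic (D z).
    by rewrite qp // (qD z) // h'p qp // hK.
  by rewrite qn' // (qn z) // qD // hp hK.
rewrite (qn (act h' z)) // hK; have [Dz|nz] := classic (D z).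
  by rewrite (qD z) // h'p qn' // hp hK.
by rewrite qn // qn // hK.
Qed.

(* An element of [Vset p] maps a point moved by [p] into its [p]-orbit, because it commutes
   with the restrictions of [p] to small invariant clopen sets; so its square fixes that point. *)
Lemma Vset_square p g x : is_involution p -> Vset (@amul X) (aone X) p g -> moves p x ->
  act g (act g x) = x.
Proof.
move=> pp Vg px; have /is_involutionE pK := pp.
have Up : Uset (@amul X) (aone X) p p.
  split=> //; split=> // h h' hh' /commutesE hp; apply/commutesE => z.
  have hK w : act h (act h' w) = w by rewrite -act_mul hh' act_one.
  by rewrite !act_mul hp hK hp hK.
have /commutesE gp := Vg _ Up.
have [e|gx] := classic (act g x = x); first by rewrite !e.
have [e|gpx] := classic (act g x = act p x); first by rewrite e gp e pK.
have [q [Uq [qx qgx]]] := involution_restriction pp gx gpx px.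
by have /(_ x) [_ /(_ qx)] := fun x => commutes_moves x (Vg _ Uq).
Qed.

(** Where [p] moves points, squares of elements of [Vset p] are trivial, so an element supported
    there commutes with them. Conversely, everything supported in a small set of fixed points of [p]
    lies in [Vset p]; if [g] displaced this set and commuted with the square of [h], that square
    would fix [y]. *)
Lemma WsetE p g : is_involution p ->
  Wset (@amul X) (aone X) p g <-> (forall x, moves g x -> moves p x).
Proof.
move=> pp; split=> [Wg x gx px|gp h Vh]; last first.
  apply: disjoint_commutes => x /gp px; apply; rewrite act_mul.
  exact: Vset_square pp Vh px.
have [A [oA [Ax [Ap Ag]]]] := displaced_neighbourhood pp px gx.
have [h [y [hA hhy]]] := local_nonsquare oA Ax.
have Vh : Vset (@amul X) (aone X) p h.
  by move=> k Uk; apply: disjoint_commutes => z /hA/Ap pz /(Uset_moves pp Uk).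
have /commutesE/(_ y) := Wg _ Vh; rewrite !act_mul => e.
have Ay : A y by apply: hA => hy; apply: hhy; rewrite hy hy.
have hgy : act h (act g y) = act g y by apply: NNPP => /hA/(Ag _ Ay).
by apply: hhy; apply: (@act_inj g); rewrite e hgy hgy.
Qed.

End Support.

(** * Matching points along a group isomorphism *)

Section Correspondence.
Variables (X Y : action) (f : gr X -> gr Y).
Hypotheses (f_bij : bijective f) (fM : forall a b, f (amul a b) = amul (f a) (f b)).

Definition matched (x : pt X) (y : pt Y) :=
  forall p, is_involution p -> (moves p x <-> moves (f p) y).

Lemma morph_one : f (aone X) = aone Y.
Proof.
apply: act_faithful => y; rewrite act_one.
apply: (@act_inj _ (f (aone X))); rewrite -act_mul -fM; congr (act (f _) y).
by apply: act_faithful => x; rewrite act_mul !act_one.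
Qed.

Lemma is_involution_morph p : is_involution p <-> is_involution (f p).
Proof. by rewrite /is_involution -fM -morph_one; split=> [->//|/(bij_inj f_bij)]. Qed.

Lemma subsupport_morph p g : is_involution p ->
  (forall x, moves g x -> moves p x) <-> (forall y, moves (f g) y -> moves (f p) y).
Proof.
move=> pp; rewrite -(WsetE g pp) -WsetE; last exact/is_involution_morph.
exact: Wset_iso f_bij fM morph_one p g.
Qed.

Lemma moves_open (Z : action) (g : gr Z) : aopen (moves g).
Proof.
apply: aopen_local => x gx; have [A [oA [cA [Ax nA]]]] := separated gx.
exists (fun z => A (act g z) /\ ~ A z); split; last by split=> // z [Agz nAz] e; apply: nAz; rewrite -e.
by apply: aopenI => //; apply: aopen_preim.
Qed.

(** Disjointness reduces to inclusion: by [local_involution] an overlap of two moved sets contains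
    the moved set of a nontrivial element. *)
Lemma disjoint_morph p q : is_involution p -> is_involution q ->
  (forall x, moves p x -> ~ moves q x) -> forall y, moves (f p) y -> ~ moves (f q) y.
Proof.
move=> pp qq dis y py qy.
have [|k [kk [k1 kA]]] := @local_involution Y (fun y => moves (f p) y /\ moves (f q) y) y _ (conj py qy).
  by apply: aopenI; apply: moves_open.
case: f_bij => g fK gK; move: kk k1 kA; rewrite -(gK k); set h := g k => kk k1 kA.
have hp x : moves h x -> moves p x by move: x; apply/(subsupport_morph h pp) => z /kA[].
have hq x : moves h x -> moves q x by move: x; apply/(subsupport_morph h qq) => z /kA[].
apply: k1; rewrite -morph_one; congr (f _); apply: act_faithful => x; rewrite act_one.
by apply: NNPP => hx; apply: (dis x); auto.
Qed.


(** If every point moved by [f p0] disagreed with [x] on some involution, finitely many involutions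
    would witness this by compactness. Take a nontrivial [g] supported so near [x] that each of them
    moves all of its support or none of it: a point moved by [f g] agrees with [x] on all of
    them. *)
Lemma matched_exists x : exists y, matched x y.
Proof.
apply: NNPP => nex.
have one2 : is_involution (aone X) by apply: act_faithful => z; rewrite act_mul !act_one.
(* The fixed set of the unit serves as the whole space, open by [fixed_open]. *)
have [p0 [_ [pp0 [_ [p0x _]]]]] := involution_subbasis (fixed_open one2) (act_one x).
pose I := {p : gr X | is_involution p}.
pose O (i : I) y := ~ (moves (sval i) x <-> moves (f (sval i)) y).
have oO i : aopen (O i).
  case: i => p pp; have fpp := (is_involution_morph p).1 pp.
  have [px|px] := classic (moves p x).
    by apply: (aopen_ext (fixed_open fpp)) => y; rewrite /O /moves /=; tauto.
  by apply: (aopen_ext (moves_open (f p))) => y; rewrite /O /=; tauto.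
have cov y : moves (f p0) y -> exists i, O i y.
  move=> _; apply: NNPP => nO; apply: nex; exists y => p pp; apply: NNPP => npy.
  by apply: nO; exists (exist _ p pp).
have [s sO] := moved_compact ((is_involution_morph p0).1 pp0) oO cov.
have [N [oN [Nx NP]]] : exists N, aopen N /\ N x /\
    forall z, N z -> forall i, List.In i s -> (moves (sval i) z <-> moves (sval i) x).
  elim: s {sO} => [|[p pp] s [N [oN [Nx NP]]]].
    by exists (fun x => act (aone X) x = x); split; [apply: fixed_open | rewrite act_one].
  exists (fun z => N z /\ (moves p z <-> moves p x)); split.
    apply: aopenI => //; have [px|px] := classic (moves p x).
      by apply: (aopen_ext (moves_open p)) => z; tauto.
    by apply: (aopen_ext (fixed_open pp)) => z; rewrite /moves in px *; tauto.
  by split=> // z [Nz pz] i [<-//|/NP]; apply.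
have [|g [gg [g1 gN]]] := @local_involution X (fun z => N z /\ moves p0 z) x _ (conj Nx p0x).
  by apply: aopenI => //; apply: moves_open.
have [y gy] : exists y, moves (f g) y.
  apply: NNPP => nex'; apply: g1; apply: (bij_inj f_bij); rewrite morph_one.
  by apply: act_faithful => y; rewrite act_one; apply: NNPP => gy; apply: nex'; exists y.
have p0y : moves (f p0) y.
  by move: y gy; apply/(subsupport_morph g pp0) => z /gN[].
have [[p pp] [/NP pN Op]] := sO _ p0y; apply: Op => /=.
have [px|px] := classic (moves p x).
  have : moves (f p) y; last by tauto.
  by move: y gy {p0y}; apply/(subsupport_morph g pp) => z /gN[/pN /=]; tauto.
have : ~ moves (f p) y; last by tauto.
by apply: disjoint_morph gy => // z /gN[/pN /=]; tauto.
Qed.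

Lemma matched_fun x y y' : matched x y -> matched x y' -> y = y'.
Proof.
move=> m m'; apply: NNPP => /separated[A [oA [_ [Ay nAy']]]].
have [p [q [pp [qq [py [qy pqA]]]]]] := involution_subbasis oA Ay.
case: (f_bij) => g fK gK.
have tr k : is_involution k -> moves k y -> moves k y'.
  rewrite -(gK k) => /is_involution_morph kk.
  by move=> /(m _ kk)/(m' _ kk).
by apply: nAy'; apply: pqA; apply: tr.
Qed.

Lemma matched_act g x y : matched x y -> matched (act g x) (act (f g) y).
Proof.
move=> m p pp; set q := amul (ainv g) (amul p g).
have qE z : act q z = act (ainv g) (act p (act g z)) by rewrite !act_mul.
have qq : is_involution q.
  apply/is_involutionE => z; rewrite !qE act_invKV; move/is_involutionE: pp => ->.
  by rewrite act_invK.
have fq z : act (f g) (act (f q) z) = act (f p) (act (f g) z).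
  rewrite -!act_mul -!fM; congr (act (f _) z); apply: act_faithful => w.
  by rewrite !act_mul act_invKV.
have -> : moves p (act g x) <-> moves q x.
  rewrite /moves qE; split=> h e; apply: h; first by rewrite -{2}e act_invKV.
  by rewrite e act_invK.
rewrite (m _ qq) /moves -fq; split=> h e; apply: h; last by rewrite e.
exact: act_inj e.
Qed.

Lemma matched_open x y (B : pt Y -> Prop) : matched x y -> aopen B -> B y ->
  exists A, aopen A /\ A x /\ forall x' y', matched x' y' -> A x' -> B y'.
Proof.
move=> m oB By; have [p [q [pp [qq [py [qy pqB]]]]]] := involution_subbasis oB By.
case: (f_bij) => g fK gK; move: pp qq py qy pqB; rewrite -(gK p) -(gK q).
move: {p q} (g p) (g q) => p q /is_involution_morph pp /is_involution_morph qq.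
move=> /(m _ pp) px /(m _ qq) qx pqB.
exists (fun z => moves p z /\ moves q z); split; first by apply: aopenI; apply: moves_open.
by split=> // x' y' m' [/(m' _ pp) py' /(m' _ qq) qy']; apply: pqB.
Qed.

End Correspondence.

Lemma matched_inv (X Y : action) (f : gr X -> gr Y) (g : gr Y -> gr X) x y :
  cancel f g -> cancel g f -> (forall a b, f (amul a b) = amul (f a) (f b)) ->
  matched f x y <-> matched g y x.
Proof.
move=> fK gK fM; have fb : bijective f by exists g.
split=> m p pp.
  rewrite -{1}(gK p); apply: iff_sym; apply: m.
  by apply/(is_involution_morph fb fM); rewrite gK.
by rewrite -{1}(fK p); apply: iff_sym; apply: m; apply/(is_involution_morph fb fM).
Qed.

Lemma spatial_realization (X Y : action) (f : gr X -> gr Y) :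
  bijective f -> (forall a b, f (amul a b) = amul (f a) (f b)) ->
  exists (u : pt X -> pt Y) (v : pt Y -> pt X), cancel u v /\ cancel v u /\
    continuous_wrt (@aopen X) (@aopen Y) u /\ continuous_wrt (@aopen Y) (@aopen X) v /\
    forall g x, u (act g x) = act (f g) (u x).
Proof.
move=> fb fM; case: (fb) => g fK gK; have gb : bijective g by exists f.
have gM a b : g (amul a b) = amul (g a) (g b) by rewrite -{1}(gK a) -{1}(gK b) -fM fK.
have [u mu] := functional_choice _ (matched_exists fb fM).
have [v mv] := functional_choice _ (matched_exists gb gM).
have mfg x y := matched_inv x y fK gK fM.
exists u, v; split=> [x|].
  by apply: (matched_fun gb gM) (mv _) _; apply/mfg.
split=> [y|]; first by apply: (matched_fun fb fM) (mu _) _; apply/mfg.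
split=> [B oB|].
  apply: aopen_local => x Bx; have [A [oA [Ax AP]]] := matched_open fb fM (mu x) oB Bx.
  by exists A; do 2 split=> //; move=> z; apply: AP.
split=> [B oB|]; last by move=> h x; apply: (matched_fun fb fM) (mu _) _; apply: matched_act.
apply: aopen_local => x Bx; have [A [oA [Ax AP]]] := matched_open gb gM (mv x) oB Bx.
by exists A; do 2 split=> //; move=> z; apply: AP.
Qed.

(** * Boundary paths *)

Section Paths.
Variable E : graph.
Implicit Types (v w : vtx E) (e : edg E) (l a b c t : seq (edg E)) (x y z : bpath E).

Lemma bE_eq (x y : bE E) : sval x = sval y -> x = y.
Proof.
case: x y => [x Px] [y Py] /= e; move: Py; rewrite -e => Py.
by rewrite (proof_irrelevance _ Px Py).
Qed.

Lemma is_path_cat v a b : is_path v (a ++ b) <-> is_path v a /\ is_path (prange v a) b.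
Proof. by elim: a v => [|e a IH] v /=; [tauto | rewrite IH; tauto]. Qed.

Lemma prange_cat v a b : prange v (a ++ b) = prange (prange v a) b.
Proof. by elim: a v => //=. Qed.

Definition bcons e (x : bpath E) : bpath E :=
  match x with
  | Fin _ l => Fin (sc e) (e :: l)
  | Inf f => Inf (fun i => if i is j.+1 then f j else e)
  end.

Definition bcat l (x : bpath E) : bpath E := foldr bcons x l.

Lemma bcat_cat a b x : bcat (a ++ b) x = bcat a (bcat b x).
Proof. exact: foldr_cat. Qed.

Lemma bsrc_cons e x : bsrc (bcons e x) = sc e.
Proof. by case: x. Qed.

Lemma bsrc_cat v l x : is_path v l -> bsrc x = prange v l -> bsrc (bcat l x) = v.
Proof. by case: l => //= e l [<- _] _; rewrite bsrc_cons. Qed.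

Lemma shift_cons e x : bsrc x = rg e -> shift (bcons e x) = x.
Proof. by case: x => //= v l ->. Qed.

Lemma shift_cat v l x : is_path v l -> bsrc x = prange v l -> iter (size l) (@shift E) (bcat l x) = x.
Proof.
elim: l v => //= e l IH v [_ el] xl.
by rewrite -iterS iterSr shift_cons ?(IH (rg e)) // (bsrc_cat el).
Qed.

Lemma len_ge_cat l x : len_ge (bcat l x) (size l).
Proof. by elim: l => //= [|e l]; [case: x | case: (bcat l x)]. Qed.

Lemma valid_shift x : bvalid x -> bvalid (shift x).
Proof. by case: x => [v [|e l]|f] //= [[_ ?] ?]. Qed.

Lemma valid_cons e x : bvalid x -> bsrc x = rg e -> bvalid (bcons e x).
Proof. by case: x => [v l [p s]|f vf] /=; [move=> <- | move=> h [|i] //=]. Qed.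

Lemma valid_cat v l x : is_path v l -> bsrc x = prange v l -> bvalid x -> bvalid (bcat l x).
Proof.
by elim: l v => //= e l IH v [_ el] xl vx; apply: valid_cons;
  [apply: IH el xl vx | apply: bsrc_cat el xl].
Qed.

Lemma decomposition x m : bvalid x -> len_ge x m ->
  exists l, size l = m /\ is_path (bsrc x) l /\ prange (bsrc x) l = bsrc (iter m (@shift E) x) /\
    x = bcat l (iter m (@shift E) x).
Proof.
elim: m x => [|m IH] x vx xm; first by exists [::].
have xm' : len_ge (shift x) m by case: x xm {vx} => [v [|e l]|f].
have [l [sl [pl [rl xl]]]] := IH _ (valid_shift vx) xm'.
have [e [xe ve]] : exists e, x = bcons e (shift x) /\ bsrc (shift x) = rg e.
  case: x vx xm {IH xm' pl rl xl} => [v [|e l']|f] //=; first by case=> [[<- _] _] _; exists e.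
  by move=> vf _; exists (f 0); split; [congr Inf; apply: functional_extensionality => -[] | rewrite vf].
exists (e :: l); rewrite iterSr /= sl; split=> //.
by rewrite {1 3}xe bsrc_cons -ve -xl.
Qed.

Lemma in_Z_nil v x : in_Z v [::] x <-> bsrc x = v.
Proof.
split=> [[]//|xv]; split=> //.
by case: x xv => // w l _; exists l.
Qed.

Lemma in_Z_cons v e e' l x : bsrc x = rg e ->
  in_Z v (e' :: l) (bcons e x) <-> e' = e /\ v = sc e /\ in_Z (rg e) l x.
Proof.
case: x => [w k /= ->|f fe]; rewrite /in_Z.
  split=> [[<- [t [<- ->]]]|[-> [-> [_ [t ->]]]]]; first by do 3 split=> //; exists t.
  by split=> //; exists t.
rewrite /= -[1]/(1 + 0) iotaDl -map_comp; split.
  by case=> -> [-> {1}->]; do 3 split=> //.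
by case=> -> [-> [_ {1}->]].
Qed.

Lemma in_Z_cat v l t x : is_path v l -> bsrc x = prange v l ->
  in_Z v (l ++ t) (bcat l x) <-> in_Z (prange v l) t x.
Proof.
elim: l v => //= e l IH v [ev el] xl.
by rewrite in_Z_cons ?(bsrc_cat el) // IH // ev; tauto.
Qed.

Lemma in_Z_cat_same v l x : is_path v l -> bsrc x = prange v l -> in_Z v l (bcat l x).
Proof. by move=> pl xl; rewrite -{1}(cats0 l) in_Z_cat // in_Z_nil. Qed.

Lemma in_Z_cat_eq v w k l x : is_path w k -> bsrc x = prange w k -> size l = size k ->
  in_Z v l (bcat k x) -> v = w /\ l = k.
Proof.
elim: k l v w => [|e k IH] [|e' l] v w //=; first by move=> _ xw _ /in_Z_nil <-.
by move=> [ew pk] xk [sl]; rewrite in_Z_cons ?(bsrc_cat pk) //; case=> -> [-> /(IH _ _ _ pk xk sl)[_ ->]].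
Qed.

Lemma in_Z_len v l x : in_Z v l x -> len_ge x (size l).
Proof. by case: x => //= w k [_ [t ->]]; rewrite size_cat leq_addr. Qed.

Lemma valid_iter n x : bvalid x -> bvalid (iter n (@shift E) x).
Proof. by move=> vx; elim: n => //= n; apply: valid_shift. Qed.

(** This turns the edgewise definition of cylinders into concatenation with a boundary path, the
    form on which prefix replacement rests. *)
Lemma in_ZP v l x : bvalid x -> in_Z v l x <->
  exists x0 : bE E, is_path v l /\ bsrc (sval x0) = prange v l /\ x = bcat l (sval x0).
Proof.
move=> vx; split=> [xl|[x0 [pl [sx0 ->]]]]; last exact: in_Z_cat_same.
have [k [sk [pk [rk xk]]]] := decomposition vx (in_Z_len xl).
have [-> lk] : v = bsrc x /\ l = k.
  by move: (xl); rewrite {1}xk; apply: in_Z_cat_eq => //; rewrite rk.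
by rewrite lk sk in rk pk xk *; exists (exist _ _ (valid_iter (size l) vx)).
Qed.

Lemma in_Z_path v l x : bvalid x -> in_Z v l x -> is_path v l.
Proof. by move=> vx /(in_ZP _ _ vx)[x0 []]. Qed.

Lemma in_Z_take v l t x : in_Z v (l ++ t) x -> in_Z v l x.
Proof.
case: x => [w k|f] /= [wv].
  by case=> u ->; split=> //; exists (t ++ u); rewrite catA.
rewrite size_cat iotaD map_cat => /eqP; rewrite eqseq_cat ?size_map ?size_iota //.
by case/andP=> /eqP lf _.
Qed.

Lemma in_Z_prefix v w l k x : in_Z v l x -> in_Z w k x -> size l <= size k -> v = w /\ exists t, k = l ++ t.
Proof.
case: x => [u m|f] [<- lx] [<- kx] lk; split=> //.
  case: lx kx => t -> [t' e]; exists (drop (size l) k).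
  by rewrite -{1}(take_size_cat t (erefl (size l))) e takel_cat // cat_take_drop.
exists (drop (size l) k); rewrite {1}kx -(subnKC lk) iotaD map_cat -lx; congr (_ ++ _).
by rewrite {2}kx -map_drop drop_iota.
Qed.

Lemma in_Z_determined v w l k x : in_Z v l x -> size k <= size l ->
  in_Z w k x <-> w = v /\ k = take (size k) l.
Proof.
move=> lx kl; split=> [kx|[-> ke]].
  by have [-> [t ->]] := in_Z_prefix kx lx kl; rewrite take_size_cat.
by move: lx; rewrite -(cat_take_drop (size k) l) -ke; apply: in_Z_take.
Qed.

Lemma bcat_inj a x y v w : is_path v a -> is_path w a -> bsrc x = prange v a -> bsrc y = prange w a ->
  bcat a x = bcat a y -> x = y.
Proof. by move=> va wa xa ya e; rewrite -(shift_cat va xa) e (shift_cat wa ya). Qed.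

End Paths.

(** * Topology of the boundary path space *)

Section Topology.
Variable E : graph.
Implicit Types (v w : vtx E) (e : edg E) (l a b c t : seq (edg E)) (x y z : bE E).
Implicit Types (Ls : seq (vtx E * seq (edg E))) (O : bE E -> Prop).

(* The topology is induced from the product topology by the map recording the membership of a
   boundary path in each cylinder; a finite list [Ls] of cylinders gives a basic neighbourhood. *)
Definition agree Ls (x y : bpath E) :=
  forall v l, (v, l) \in Ls -> (in_Z v l x <-> in_Z v l y).

Lemma agree_cat Ls Ls' (x y : bpath E) : agree (Ls ++ Ls') x y <-> agree Ls x y /\ agree Ls' x y.
Proof.
split=> [h|[h h'] v l]; last by rewrite mem_cat => /orP[/h|/h'].
by split=> v l Lv; apply: h; rewrite mem_cat Lv ?orbT.
Qed.

Lemma agree_cons v l Ls (x y : bpath E) :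
  agree ((v, l) :: Ls) x y <-> (in_Z v l x <-> in_Z v l y) /\ agree Ls x y.
Proof.
rewrite -[_ :: _]/([:: (v, l)] ++ Ls) agree_cat.
split=> -[h h']; split=> //; first by apply: h; rewrite inE.
by move=> w k; rewrite inE => /eqP[-> ->].
Qed.

Lemma agree_sym Ls (x y : bpath E) : agree Ls x y -> agree Ls y x.
Proof. by move=> h v l /h; tauto. Qed.

Lemma agree_trans Ls (x y z : bpath E) : agree Ls x y -> agree Ls y z -> agree Ls x z.
Proof. by move=> h h' v l L; rewrite h // h'. Qed.

(** A point outside the cylinder of [l] is treated at the longest prefix of [l] that it follows:
    there the next edge of [l] is removed. A next edge that does not compose needs no removal, as
    its cylinder is empty. *)
Lemma Z_basic_separating v l x : exists B : bE E -> Prop, Z_basic B /\ B x /\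
  forall z, B z -> (in_Z v l (sval x) <-> in_Z v l (sval z)).
Proof.
have cyl w k : is_path w k -> Z_basic (fun z : bE E => in_Z w k (sval z)).
  by exists w, k, [::]; split=> //; split=> // z; split=> [|[]].
have [xl|] := classic (in_Z v l (sval x)).
  exists (fun z => in_Z v l (sval z)); split; last by split=> // z; tauto.
  exact/cyl/(in_Z_path (svalP x) xl).
elim/last_ind: l => [|l e IH] nx.
  exists (fun z => in_Z (bsrc (sval x)) [::] (sval z)); split; first exact: cyl.
  by split=> [|z]; rewrite !in_Z_nil // => ->; split.
have sub z : in_Z v (rcons l e) (sval z) -> in_Z v l (sval z) by rewrite -cats1; apply: in_Z_take.
have [xl|nxl] := classic (in_Z v l (sval x)); last first.
  have [B [oB [Bx BP]]] := IH nxl; exists B; do 2 split=> //.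
  by move=> z /BP Bz; split=> // /sub; tauto.
have pl := in_Z_path (svalP x) xl.
have [ev|ne] := classic (sc e = prange v l); last first.
  exists (fun z => in_Z v l (sval z)); split; first exact: cyl.
  split=> // z _; split=> // /(in_Z_path (svalP z)).
  by rewrite -cats1 is_path_cat /=; tauto.
exists (fun z => in_Z v l (sval z) /\ forall f, f \in [:: e] -> ~ in_Z v (rcons l f) (sval z)).
split; first by exists v, l, [:: e]; do 2 split=> //; move=> f; rewrite inE => /eqP ->.
split; first by split=> // f; rewrite inE => /eqP ->.
by move=> z [_ /(_ e)]; rewrite mem_head => /(_ isT); tauto.
Qed.

Lemma bE_openP O : bE_open O <->
  forall x, O x -> exists Ls, forall z, agree Ls (sval x) (sval z) -> O z.
Proof.
split=> oO x Ox.
  have [Bs [ZB [Bx BO]]] := oO x Ox.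
  have [Ls LsP] : exists Ls, forall z, agree Ls (sval x) (sval z) -> forall B, List.In B Bs -> B z.
    elim: Bs ZB Bx {BO} => [|B Bs IH] ZB Bx; first by exists [::].
    have [Ls LsP] := IH (fun B h => ZB B (or_intror h)) (fun B h => Bx B (or_intror h)).
    have [v [l [F [_ [_ BE]]]]] := ZB B (or_introl erefl).
    exists (((v, l) :: [seq (v, rcons l e) | e <- F]) ++ Ls) => z.
    rewrite agree_cat agree_cons => -[[zl zF] zL] B' [<-|]; last exact: LsP.
    have /BE[xl xF] := Bx B (or_introl erefl).
    apply/BE; split=> [|e eF]; first exact/zl.
    by rewrite -zF; [apply: xF | apply: map_f].
  by exists Ls => z /LsP; apply: BO.
have [Ls LsO] := oO x Ox.
have [Bs [ZB [Bx BL]]] : exists Bs : seq (bE E -> Prop), (forall B, List.In B Bs -> Z_basic B) /\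
    (forall B, List.In B Bs -> B x) /\
    forall z, (forall B, List.In B Bs -> B z) -> agree Ls (sval x) (sval z).
  elim: Ls {LsO} => [|[v l] Ls [Bs [ZB [Bx BL]]]]; first by exists [::].
  have [B [oB [Bx' BP]]] := Z_basic_separating v l x.
  exists (B :: Bs); split=> [B' [<-|/ZB]//|]; split=> [B' [<-|/Bx]//|z zB].
  by rewrite agree_cons; split; [apply: BP; apply: zB; left | apply: BL => B' ?; apply: zB; right].
by exists Bs; do 2 split=> //; move=> z /BL/LsO.
Qed.

Lemma open_agree Ls x : bE_open (fun z => agree Ls (sval x) (sval z)).
Proof. by apply/bE_openP => y xy; exists Ls => z; apply: agree_trans. Qed.

Lemma bE_open_ext O O' : bE_open O -> (forall x, O x <-> O' x) -> bE_open O'.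
Proof.
move=> /bE_openP oO OO'; apply/bE_openP => x /OO' /oO[Ls LO].
by exists Ls => z /LO /OO'.
Qed.

Lemma bE_open_local O :
  (forall x, O x -> exists O', bE_open O' /\ O' x /\ forall z, O' z -> O z) -> bE_open O.
Proof.
move=> h; apply/bE_openP => x /h[O' [/bE_openP oO [O'x sub]]].
by have [Ls LO] := oO x O'x; exists Ls => z /LO /sub.
Qed.

Lemma bE_openI O O' : bE_open O -> bE_open O' -> bE_open (fun x => O x /\ O' x).
Proof.
move=> /bE_openP oO /bE_openP oO'; apply/bE_openP => x [/oO[Ls h] /oO'[Ls' h']].
by exists (Ls ++ Ls') => z; rewrite agree_cat => -[/h ? /h'].
Qed.

Lemma bE_openU O O' : bE_open O -> bE_open O' -> bE_open (fun x => O x \/ O' x).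
Proof.
move=> oO oO'; apply: bE_open_local => x [Ox|Ox]; [exists O | exists O'];
  do 2 split=> //; auto.
Qed.

Lemma bE_openT : bE_open (fun _ : bE E => True).
Proof. by apply/bE_openP => x _; exists [::]. Qed.

Lemma open_Z v l : bE_open (fun z : bE E => in_Z v l (sval z)).
Proof. by apply/bE_openP => x xl; exists [:: (v, l)] => z /(_ v l); rewrite mem_head => /(_ isT); tauto. Qed.

Lemma closed_Z v l : bE_open (fun z : bE E => ~ in_Z v l (sval z)).
Proof. by apply/bE_openP => x xl; exists [:: (v, l)] => z /(_ v l); rewrite mem_head => /(_ isT); tauto. Qed.

Lemma cylinders_separate x y : (forall v l, in_Z v l (sval x) <-> in_Z v l (sval y)) -> x = y.
Proof.
move=> h; apply: bE_eq; case: x y h => [x Px] [y Py] /= {Px Py}.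
have fi v l f : ~ (forall w k, in_Z w k (Fin v l : bpath E) <-> in_Z w k (Inf f)).
  move=> h; have /h[_ [t /(congr1 size)]] : in_Z (bsrc (Inf f)) [seq f i | i <- iota 0 (size l).+1] (Inf f).
    by split=> //; rewrite size_map size_iota.
  by rewrite size_cat size_map size_iota; lia.
case: x y => [v l|f] [w k|g] h.
- have [_ [t ke]] : in_Z v l (Fin w k) by apply/h; split=> //; exists [::]; rewrite cats0.
  have [<- [t' le]] : in_Z w k (Fin v l) by apply/h; split=> //; exists [::]; rewrite cats0.
  move: (congr1 size le) (congr1 size ke); rewrite !size_cat => s1 s2.
  by congr Fin; rewrite le (size0nil (_ : size t' = 0)) ?cats0 //; lia.
- by case: (fi v l g).
- by case: (fi w k f) => u m; rewrite h.
congr Inf; apply: functional_extensionality => n.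
have [_] : in_Z (bsrc (Inf f)) [seq f i | i <- iota 0 n.+1] (Inf g).
  by apply/h; split=> //; rewrite size_map size_iota.
rewrite size_map size_iota => /(congr1 (fun s => nth (f 0) s n)).
by rewrite !(nth_map 0) ?size_iota // nth_iota.
Qed.

Lemma bE_separated x y : x <> y ->
  exists A, bE_open A /\ bE_open (fun z => ~ A z) /\ A x /\ ~ A y.
Proof.
move=> xy; have [v [l h]] : exists v l, ~ (in_Z v l (sval x) <-> in_Z v l (sval y)).
  apply: NNPP => h; apply: xy; apply: cylinders_separate => v l; apply: NNPP => h'.
  by apply: h; exists v, l.
have [xl|xl] := classic (in_Z v l (sval x)).
  exists (fun z => in_Z v l (sval z)); split; first exact: open_Z.
  by split; [apply: closed_Z | tauto].
exists (fun z => ~ in_Z v l (sval z)); split; first exact: closed_Z.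
by split; [refine (bE_open_ext (@open_Z v l) _) => z | ]; tauto.
Qed.

(** Of each listed path only the edge following [l] matters: excluding these finitely many edges
    excludes all listed cylinders properly beyond [l], and the shorter ones are decided by [l]. *)
Lemma neighbourhood_finite Ls v l : is_path v l -> exists F : seq (edg E), forall z,
  in_Z v l (sval z) -> (forall e, e \in F -> ~ in_Z v (rcons l e) (sval z)) ->
  agree Ls (Fin v l) (sval z).
Proof.
move=> pl; exists (flatten [seq take 1 (drop (size l) p.2) | p <- Ls]) => z zl zF w k wk.
have pll : in_Z v l (Fin v l) by split=> //; exists [::]; rewrite cats0.
have [kl|lk] := leqP (size k) (size l); first by rewrite (in_Z_determined _ pll kl) (in_Z_determined _ zl kl).
split=> [[_ [t /(congr1 size)]]|kz]; first by rewrite size_cat; lia.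
have [vw [t kE]] := in_Z_prefix zl kz (ltnW lk); subst w.
case: t kE => [|e t] kE; first by move: lk; rewrite kE cats0 ltnn.
case: (zF e); last by apply: (@in_Z_take _ _ _ t); rewrite cat_rcons -kE; exact: kz.
apply/flattenP; exists (take 1 (drop (size l) k)); first by apply/mapP; exists (v, k).
by rewrite kE drop_size_cat //= take0 inE.
Qed.

Lemma neighbourhood_infinite Ls (f : nat -> edg E) : exists n, forall z,
  in_Z (sc (f 0)) [seq f i | i <- iota 0 n] (sval z) -> agree Ls (Inf f) (sval z).
Proof.
exists (\max_(p <- Ls) size p.2) => z zf w k wk.
set n := \max_(p <- Ls) _ in zf.
have kn : size k <= size [seq f i | i <- iota 0 n].
  by rewrite size_map size_iota; exact: (@leq_bigmax_seq _ Ls xpredT (fun p => size p.2) (w, k) wk isT).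
have ff : in_Z (sc (f 0)) [seq f i | i <- iota 0 n] (Inf f) by split=> //; rewrite size_map size_iota.
by rewrite (in_Z_determined _ ff kn) (in_Z_determined _ zf kn).
Qed.

End Topology.

(** * Compactness of closed sets of paths with a common source *)

Section Compactness.
Variable E : graph.
Implicit Types (w : vtx E) (e : edg E) (l a b c t : seq (edg E)) (x y z : bE E).

Lemma path_mkseq v (f : nat -> edg E) :
  (forall n, is_path v [seq f i | i <- iota 0 n]) -> bvalid (Inf f) /\ sc (f 0) = v.
Proof.
move=> pf; split; last by have [] := pf 1.
move=> i; have := pf i.+2.
rewrite -addn2 iotaD map_cat is_path_cat add0n /= => -[_ []].
by move=> _ [].
Qed.

Lemma next_edge v l x : in_Z v l (sval x) -> ~ singular (prange v l) ->
  exists e, sc e = prange v l /\ in_Z v (rcons l e) (sval x).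
Proof.
move=> /(in_ZP _ _ (svalP x))[x0 [pl [sx ->]]] ns.
have [e [se xe]] : exists e, sc e = bsrc (sval x0) /\ in_Z (bsrc (sval x0)) [:: e] (sval x0).
  case: x0 sx => [[w [|e k]|f] /= vx0] sx; first by case: vx0; rewrite sx.
    by exists e; case: vx0 => -[<- _] _; split=> //; split=> //; exists k.
  by exists (f 0).
by exists e; rewrite se -cats1; split=> //; rewrite (in_Z_cat _ pl sx) -sx.
Qed.

Section Cover.
Variables (v : vtx E) (K : bE E -> Prop) (I : Type) (O : I -> bE E -> Prop).
Hypotheses (K_closed : bE_open (fun x => ~ K x)) (K_src : forall x, K x -> bsrc (sval x) = v).
Hypotheses (O_open : forall i, bE_open (O i)) (O_cover : forall x, K x -> exists i, O i x).

Definition finitely_covered (P : bE E -> Prop) :=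
  exists s : seq I, forall x, K x -> P x -> exists i, List.In i s /\ O i x.

Lemma finitely_coveredU P Q : finitely_covered P -> finitely_covered Q ->
  finitely_covered (fun x => P x \/ Q x).
Proof.
move=> [s sP] [s' sQ]; exists (s ++ s') => x Kx [/(sP x Kx)|/(sQ x Kx)] [i [si Oi]];
  by exists i; rewrite List.in_app_iff; auto.
Qed.

Lemma finitely_covered_edges l (F : seq (edg E)) :
  (forall e, finitely_covered (fun x => in_Z v (rcons l e) (sval x))) ->
  finitely_covered (fun x => exists2 e, e \in F & in_Z v (rcons l e) (sval x)).
Proof.
move=> fe; elim: F => [|e F IH]; first by exists [::] => x _ [].
have [s sP] := finitely_coveredU (fe e) IH; exists s => x Kx [f].
rewrite inE => /predU1P[-> xf|fF xf]; first by apply: sP => //; left.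
by apply: sP => //; right; exists f.
Qed.

Lemma neighbourhood_covered x : exists Ls, finitely_covered (fun z => agree Ls (sval x) (sval z)).
Proof.
have [Kx|nK] := classic (K x).
  have [i Oi] := O_cover Kx; have /bE_openP/(_ _ Oi)[Ls LO] := @O_open i.
  by exists Ls, [:: i] => z _ /LO Oz; exists i; split=> //; left.
have /bE_openP/(_ _ nK)[Ls LO] := K_closed.
by exists Ls, [::] => z Kz /LO.
Qed.

(** At a singular range, [l] itself is a boundary path with a covered neighbourhood, outside which
    only the finitely many edges of [F] remain; at any other range only finitely many edges leave.
    So covers of all one-edge extensions would combine to a finite cover. *)
Lemma uncovered_step l : is_path v l -> ~ finitely_covered (fun x => in_Z v l (sval x)) ->
  exists e, is_path v (rcons l e) /\ ~ finitely_covered (fun x => in_Z v (rcons l e) (sval x)).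
Proof.
move=> pl ncov; apply: NNPP => nex; apply: ncov.
have cov e : finitely_covered (fun x => in_Z v (rcons l e) (sval x)).
  apply: NNPP => ncov; apply: nex; exists e; split=> //; apply: NNPP => np; apply: ncov.
  by exists [::] => x _ /(in_Z_path (svalP x)).
have [sg|nsg] := classic (singular (prange v l)).
  pose p : bE E := exist _ (Fin v l) (conj pl sg).
  have [Ls cLs] := neighbourhood_covered p.
  have [F FP] := neighbourhood_finite Ls pl.
  have [s sP] := finitely_coveredU cLs (finitely_covered_edges F cov).
  exists s => x Kx xl; apply: sP => //.
  have [xF|nF] := classic (exists2 e, e \in F & in_Z v (rcons l e) (sval x)); first by right.
  by left; apply: FP => // e eF xe; apply: nF; exists e.
have [F FP] : exists F : seq (edg E), forall e, sc e = prange v l -> e \in F.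
  by apply: NNPP => h; apply: nsg; right.
have [s sP] := finitely_covered_edges F cov; exists s => x Kx xl; apply: sP => //.
by have [e [/FP eF xe]] := next_edge xl nsg; exists e.
Qed.

(** As in Koenig's lemma, uncovered cylinders would be nested along an infinite path; this path has
    a covered neighbourhood, which contains one of them. *)
Lemma cylinder_cover : exists s : seq I, forall x, K x -> exists i, List.In i s /\ O i x.
Proof.
suff [s sP] : finitely_covered (fun x => in_Z v [::] (sval x)).
  by exists s => x Kx; apply: sP => //; apply/in_Z_nil/K_src.
apply: NNPP => ncov.
pose P := {l | is_path v l /\ ~ finitely_covered (fun x => in_Z v l (sval x))}.
have step (p : P) : exists q : P * edg E, sval q.1 = rcons (sval p) q.2.
  case: p => l [pl nl]; have [e [pe ne]] := uncovered_step pl nl.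
  by exists (exist _ (rcons l e) (conj pe ne), e).
have [g gP] := functional_choice _ step.
pose p n := iter n (fun p => (g p).1) (exist _ [::] (conj Logic.I ncov) : P).
pose f n := (g (p n)).2.
have pE n : sval (p n) = [seq f i | i <- iota 0 n].
  elim: n => // n IH; have -> : sval (p n.+1) = rcons (sval (p n)) (f n) := gP _.
  by rewrite IH -addn1 iotaD map_cat cats1.
have pf n : is_path v [seq f i | i <- iota 0 n] by rewrite -pE; case: (svalP (p n)).
have [vf f0] := path_mkseq pf.
have [Ls [s sP]] := neighbourhood_covered (exist _ (Inf f) vf).
have [n nP] := neighbourhood_infinite Ls f.
have [_ []] := svalP (p n); exists s => x Kx xn; apply: sP => //.
by apply: nP; rewrite -pE f0.
Qed.

End Cover.

Lemma closed_compact v (K : bE E -> Prop) : bE_open (fun x => ~ K x) ->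
  (forall x, K x -> bsrc (sval x) = v) -> compact_wrt (@bE_open E) K.
Proof. by move=> cK Kv I O oO cov; apply: cylinder_cover cK Kv oO cov. Qed.

Lemma compactU (K K' : bE E -> Prop) : compact_wrt (@bE_open E) K -> compact_wrt (@bE_open E) K' ->
  compact_wrt (@bE_open E) (fun x => K x \/ K' x).
Proof.
move=> cK cK' I O oO cov.
have [|s sP] := cK I O oO; first by move=> x Kx; apply: cov; left.
have [|s' sP'] := cK' I O oO; first by move=> x Kx; apply: cov; right.
by exists (s ++ s') => x [/sP|/sP'] [i [si Oi]]; exists i; rewrite List.in_app_iff; auto.
Qed.

Lemma compact_closed_sub (K K' : bE E -> Prop) : compact_wrt (@bE_open E) K ->
  bE_open (fun x => ~ K' x) -> (forall x, K' x -> K x) -> compact_wrt (@bE_open E) K'.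
Proof.
move=> cK oK' sub I O oO cov.
have [| |s sP] := cK (option I) (fun i => if i is Some j then O j else fun x => ~ K' x).
- by case.
- move=> x Kx; have [/cov[i Oi]|nK'] := classic (K' x); last by exists None.
  by exists (Some i).
exists (pmap id s) => x K'x; have [[i|] [si Oi]] := sP x (sub _ K'x) => //.
exists i; split=> //; elim: s si {sP} => //= -[j|] s IH [] //=; auto.
by move=> [->]; left.
Qed.

Definition closureB := closure_wrt (@bE_open E).

Lemma closureB_closed (A : bE E -> Prop) : bE_open (fun x => ~ closureB A x).
Proof.
apply: bE_open_local => x nA; apply: NNPP => h; apply: nA => O oO Ox.
apply: NNPP => nex; apply: h; exists O; do 2 split=> //.
by move=> z Oz cz; apply: nex; apply: cz.
Qed.

Lemma closureB_sub (A B : bE E -> Prop) : bE_open (fun x => ~ B x) -> (forall x, A x -> B x) ->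
  forall x, closureB A x -> B x.
Proof. by move=> oB AB x cx; apply: NNPP => nB; have [y [nBy /AB]] := cx _ oB nB. Qed.

Lemma sub_closureB (A : bE E -> Prop) x : A x -> closureB A x.
Proof. by move=> Ax O _ Ox; exists x. Qed.

End Compactness.

(** * Germs of prefix replacements *)

Section Germs.
Variable E : graph.
Local Notation rpath := (vtx E * seq (edg E))%type.
Implicit Types (v w : vtx E) (e : edg E) (l a b c t : seq (edg E)) (x y z : bE E).
Implicit Types (p q r : rpath) (O : bE E -> Prop) (h : bE E -> bE E) (k : int).

Definition extends p x0 x :=
  is_path p.1 p.2 /\ bsrc (sval x0) = prange p.1 p.2 /\ sval x = bcat p.2 (sval x0).

Lemma extends_Z p x : in_Z p.1 p.2 (sval x) <-> exists x0, extends p x0 x.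
Proof. exact: in_ZP (svalP x). Qed.

Lemma extends_inj p x0 x0' x : extends p x0 x -> extends p x0' x -> x0 = x0'.
Proof.
move=> [pp [s e]] [_ [s' e']]; apply: bE_eq.
by apply: (bcat_inj pp pp s s'); rewrite -e -e'.
Qed.

Lemma extends_fun p x0 x x' : extends p x0 x -> extends p x0 x' -> x = x'.
Proof. by move=> [_ [_ e]] [_ [_ e']]; apply: bE_eq; rewrite e. Qed.

Lemma extends_total p x0 : is_path p.1 p.2 -> bsrc (sval x0) = prange p.1 p.2 -> exists x, extends p x0 x.
Proof. by move=> pp s; exists (exist _ _ (valid_cat pp s (svalP x0))). Qed.

Lemma extends_cat p t x0 x : extends (p.1, p.2 ++ t) x0 x <->
  exists x1, extends p x1 x /\ extends (prange p.1 p.2, t) x0 x1.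
Proof.
rewrite /extends /= is_path_cat prange_cat; split.
  move=> [[pp pt] [s e]]; exists (exist _ _ (valid_cat pt s (svalP x0))).
  by rewrite /= (bsrc_cat pt s) e bcat_cat.
by move=> [x1 [[pp [s1 e1]] [pt [s0 e0]]]]; rewrite e1 e0 bcat_cat.
Qed.

Lemma extends_shift p x0 x : extends p x0 x -> iter (size p.2) (@shift E) (sval x) = sval x0.
Proof. by move=> [pp [s ->]]; apply: shift_cat s. Qed.

(* A finite path [p] is given by its source and its edges.  [cotail p q] is the graph of the
   partial homeomorphism of the boundary path space replacing the prefix [q] by [p]. *)
Definition cotail p q x y := exists x0, extends p x0 x /\ extends q x0 y.

Definition pdiff p q : int := ((size p.2)%:Z - (size q.2)%:Z)%R.

Lemma cotail_sym p q x y : cotail p q x y -> cotail q p y x.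
Proof. by move=> [x0 []]; exists x0. Qed.

Lemma cotail_fun p q x x' y : cotail p q x y -> cotail p q x' y -> x = x'.
Proof.
move=> [x0 [px qy]] [x1 [px' /(extends_inj qy) e]].
by rewrite -e in px'; apply: extends_fun px px'.
Qed.

Lemma cotail_inj p q x y y' : cotail p q x y -> cotail p q x y' -> y = y'.
Proof. by move=> /cotail_sym h /cotail_sym; apply: cotail_fun h. Qed.

(** Cylinders of paths no longer than [p] are decided by [p] alone; a longer one [p t] near [x] is
    read near [y] as [q t], which accounts for [Ls']. *)
Lemma cotail_continuous p q x y O : cotail p q x y -> bE_open O -> O x ->
  exists O', bE_open O' /\ O' y /\ forall z, O' z -> exists x', cotail p q x' z /\ O x'.
Proof.
move=> [x0 [px qy]] /bE_openP oO /oO[Ls LO]; have [pp [sp ex]] := px; have [pq [sq ey]] := qy.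
have qyZ : in_Z q.1 q.2 (sval y) by apply/extends_Z; exists x0.
pose Ls' := q :: [seq (q.1, q.2 ++ drop (size p.2) r.2) | r <- Ls].
exists (fun z => agree Ls' (sval y) (sval z)); split; first exact: open_agree.
split=> // z yz; have qz : in_Z q.1 q.2 (sval z) by apply/yz; rewrite // -surjective_pairing mem_head.
have [z0 qz0] := (extends_Z _ _).1 qz; have [_ [sz ez]] := qz0.
have sz' : bsrc (sval z0) = prange p.1 p.2 by rewrite sz -sp sq.
have [x' px'] := extends_total pp sz'.
exists x'; split; first by exists z0.
have pZ u u0 : extends p u0 u -> in_Z p.1 p.2 (sval u) by move=> pu; apply/extends_Z; exists u0.
apply: LO => v l vl; have [lp|pl] := leqP (size l) (size p.2).
  by rewrite (in_Z_determined _ (pZ _ _ px) lp) (in_Z_determined _ (pZ _ _ px') lp).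
have [_ [_ ex']] := px'.
have red u u0 : extends p u0 u -> in_Z v l (sval u) <->
    v = p.1 /\ take (size p.2) l = p.2 /\ in_Z (prange p.1 p.2) (drop (size p.2) l) (sval u0).
  move=> pu; have [_ [su eu]] := pu; rewrite eu -(in_Z_cat _ pp su) -eu.
  split=> [lu|[-> [<-]]]; last by rewrite size_takel ?cat_take_drop // ltnW.
  have [ev [t el]] := in_Z_prefix (pZ _ _ pu) lu (ltnW pl); rewrite -ev in lu.
  by rewrite -ev el take_size_cat // drop_size_cat // -el.
rewrite (red _ _ px) (red _ _ px').
have := yz q.1 (q.2 ++ drop (size p.2) l).
rewrite ey ez !in_Z_cat // -sp sq => yzl.
suff : (q.1, q.2 ++ drop (size p.2) l) \in Ls' by move/yzl; tauto.
by rewrite inE; apply/orP; right; apply/mapP; exists (v, l).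
Qed.

(** The middle point begins with [q] and with [q'], so one is a prefix of the other, and the surplus
    [t] is appended to the partner of the shorter one. The new pair is built from the four given
    paths, hence serves all points at once. *)
Lemma cotail_comp p q q' r x y z : cotail p q x y -> cotail q' r y z ->
  exists p' r', pdiff p' r' = (pdiff p q + pdiff q' r)%R /\
    forall x' y' z', cotail p q x' y' -> cotail q' r y' z' -> cotail p' r' x' z'.
Proof.
have le_case p1 q1 q2 r1 x1 y1 z1 : size q1.2 <= size q2.2 ->
    cotail p1 q1 x1 y1 -> cotail q2 r1 y1 z1 ->
    exists p' r', pdiff p' r' = (pdiff p1 q1 + pdiff q2 r1)%R /\
      forall x' y' z', cotail p1 q1 x' y' -> cotail q2 r1 y' z' -> cotail p' r' x' z'.
  move=> qq [u [pu qu]] [u' [qu' ru']].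
  have q1y : in_Z q1.1 q1.2 (sval y1) by apply/extends_Z; exists u.
  have q2y : in_Z q2.1 q2.2 (sval y1) by apply/extends_Z; exists u'.
  have [e1 [t e2]] := in_Z_prefix q1y q2y qq.
  exists (p1.1, p1.2 ++ t), r1; split; first by rewrite /pdiff e2 !size_cat; lia.
  move=> x' y' z' [x0 [px qy]] [x2 [qy' rz]]; exists x2; split=> //.
  move: qy'; rewrite (surjective_pairing q2) -e1 e2 extends_cat => -[x3 [qy3 t3]].
  have e3 := extends_inj qy qy3; subst x3.
  apply/extends_cat; exists x0; split=> //.
  by have [_ [<- _]] := px; have [_ [-> _]] := qy.
move=> pqx qrz; have [qq|/ltnW qq] := leqP (size q.2) (size q'.2); first exact: le_case qq pqx qrz.
have [r' [p' [d rp]]] := le_case _ _ _ _ _ _ _ qq (cotail_sym qrz) (cotail_sym pqx).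
exists p', r'; split; first by move: d; rewrite /pdiff; lia.
by move=> x' y' z' /cotail_sym px /cotail_sym qz; apply: cotail_sym; apply: rp qz px.
Qed.

Lemma inG_cotail (g : gtrip E) : inG g <-> exists p q, cotail p q (gx g) (gy g) /\ gk g = pdiff p q.
Proof.
split=> [[m [n [xm [yn [e ->]]]]]|[p [q [[x0 [px qy]] kg]]]]; last first.
  exists (size p.2), (size q.2); rewrite kg (extends_shift px) (extends_shift qy).
  by have [_ [_ ->]] := px; have [_ [_ ->]] := qy; do 2 (split; first exact: len_ge_cat).
have [a [sa [pa [ra ea]]]] := decomposition (svalP (gx g)) xm.
have [b [sb [pb [rb eb]]]] := decomposition (svalP (gy g)) yn.
exists (bsrc (sval (gx g)), a), (bsrc (sval (gy g)), b).
rewrite /pdiff /= sa sb; split=> //.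
exists (exist _ _ (valid_iter m (svalP (gx g)))); split; split=> //=; split=> //.
  by rewrite e.
by rewrite eb -e.
Qed.

(** Slices of [cotail p q] over open sets are basic open sets, with the lengths of [p] and [q] as
    exponents. Together with [G_openE] this replaces the defining basis by prefix replacements. *)
Lemma G_openI (S : grpd E -> Prop) :
  (forall g, S g -> exists p q O, bE_open O /\ O (gy (sval g)) /\
    cotail p q (gx (sval g)) (gy (sval g)) /\ gk (sval g) = pdiff p q /\
    forall g', gk (sval g') = gk (sval g) -> O (gy (sval g')) ->
      cotail p q (gx (sval g')) (gy (sval g')) -> S g') -> G_open S.
Proof.
move=> SP g /SP[p [q [O [oO [Oy [pq [kg OS]]]]]]].
pose U x := exists y, O y /\ cotail p q x y.
pose W y := O y /\ exists x, cotail p q x y.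
have eU x y : cotail p q x y ->
    iter (size p.2) (@shift E) (sval x) = iter (size q.2) (@shift E) (sval y).
  by move=> [x0 [/extends_shift-> /extends_shift->]].
have oU : bE_open U.
  apply: bE_open_local => x [y [O'y pqx]].
  have [O' [oO' [O'x O'P]]] := cotail_continuous (cotail_sym pqx) oO O'y.
  exists O'; do 2 split=> //; move=> z /O'P[y' [pq' Oy']].
  by exists y'; split=> //; apply: cotail_sym.
have oW : bE_open W.
  apply: bE_open_local => y [O'y [x pqx]].
  have [O' [oO' [O'y' O'P]]] := cotail_continuous pqx (@bE_openT E) Logic.I.
  exists (fun z => O z /\ O' z); split; first exact: bE_openI.
  by split=> // z [Oz /O'P[x' [pq' _]]]; split=> //; exists x'.
pose B (g' : grpd E) := U (gx (sval g')) /\ W (gy (sval g')) /\ gk (sval g') = pdiff p q /\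
  iter (size p.2) (@shift E) (sval (gx (sval g'))) = iter (size q.2) (@shift E) (sval (gy (sval g'))).
have BE g' : B g' <-> O (gy (sval g')) /\ cotail p q (gx (sval g')) (gy (sval g')) /\
    gk (sval g') = pdiff p q.
  split=> [[[y [Oy' pqx]] [[Oy'' [x pqy]] [-> e]]]|[Og [pqg kg']]].
    do 2 split=> //; have [x0 [px qx]] := pqx; have [x1 [px1 qx1]] := pqy.
    suff -> : gy (sval g') = y by [].
    apply: (cotail_inj _ pqx); exists x0; split=> //.
    suff -> : x0 = x1 by [].
    by apply: bE_eq; rewrite -(extends_shift px) -(extends_shift qx1).
  split; first by exists (gy (sval g')).
  split; first by split=> //; exists (gx (sval g')).
  by split; last exact: eU.
exists [:: B]; split.
  move=> _ [<-|//]; exists (size p.2), (size q.2), U, W; do 2 split=> //.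
  split; first by move=> x [y [_ [x0 [[_ [_ ->]] _]]]]; apply: len_ge_cat.
  split; first by move=> y [_ [x [x0 [_ [_ [_ ->]]]]]]; apply: len_ge_cat.
  split.
    move=> x1 x2 [y1 [_ [z1 [p1 _]]]] [y2 [_ [z2 [p2 _]]]].
    rewrite (extends_shift p1) (extends_shift p2) => /bE_eq e.
    by rewrite e in p1; apply: extends_fun p1 p2.
  split.
    move=> y1 y2 [_ [x1 [z1 [_ q1]]]] [_ [x2 [z2 [_ q2]]]].
    rewrite (extends_shift q1) (extends_shift q2) => /bE_eq e.
    by rewrite e in q1; apply: extends_fun q1 q2.
  split; last by [].
  move=> z; split.
    by move=> [x [[y [Oy' pqx]] <-]]; exists y; rewrite (eU _ _ pqx); do 2 split=> //; exists x.
  by move=> [y [[Oy' [x pqx]] <-]]; exists x; rewrite (eU _ _ pqx); split=> //; exists y.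
split=> [_ [<-|//]|g' /(_ B (or_introl erefl))/BE[Og' [pq' kg']]]; first exact/BE.
by apply: OS => //; rewrite kg kg'.
Qed.

(** The exponents [m], [n] and the lengths of [p], [q] share only their difference. If [m] does not
    exceed the length of [p], equality of the shifts at [g] forces [drop m p.2 = drop n q.2], which
    is independent of the arrow; otherwise both shifts reach into the common tail. *)
Lemma G_basic_local (B : grpd E -> Prop) g p q : G_basic B -> B g ->
  cotail p q (gx (sval g)) (gy (sval g)) -> gk (sval g) = pdiff p q ->
  exists O, bE_open O /\ O (gy (sval g)) /\
    forall g', gk (sval g') = gk (sval g) -> O (gy (sval g')) ->
      cotail p q (gx (sval g')) (gy (sval g')) -> B g'.
Proof.
move=> [m [n [U [W [oU [oW [Um [Wn [_ [_ [_ BE]]]]]]]]]]] /BE[Ux [Wy [kg e]]] pq kpq.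
have [O [oO [Oy OP]]] := cotail_continuous pq oU Ux.
exists (fun z => O z /\ W z); split; first exact: bE_openI.
split=> // g' kg' [Og' Wg'] pqg'; apply/BE; rewrite kg' kg.
have Ug' : U (gx (sval g')) by have [x' [/(cotail_fun pqg') <-]] := OP _ Og'.
do 3 split=> //; have {kpq}kpq : (size p.2 + n = size q.2 + m)%N by move: kpq; rewrite kg /pdiff; lia.
have [mp|/ltnW pm] := leqP m (size p.2).
  have nq : n <= size q.2 by lia.
  have dr r j x0 x : j <= size r.2 -> extends r x0 x ->
      iter j (@shift E) (sval x) = bcat (drop j r.2) (sval x0) /\
      is_path (prange r.1 (take j r.2)) (drop j r.2) /\
      bsrc (sval x0) = prange (prange r.1 (take j r.2)) (drop j r.2).
    move=> jr [pr [s ->]]; rewrite -{1}(cat_take_drop j r.2) bcat_cat.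
    move: pr s; rewrite -{1 2}(cat_take_drop j r.2) is_path_cat prange_cat => -[p1 p2] s.
    by rewrite -{1}(size_takel jr) (shift_cat p1) // (bsrc_cat p2 s).
  have [x0 [px qy]] := pq; have [z0 [px' qy']] := pqg'.
  have [ex [dp sx]] := dr _ _ _ _ mp px; have [ey [dq sy]] := dr _ _ _ _ nq qy.
  have [-> _] := dr _ _ _ _ mp px'; have [-> _] := dr _ _ _ _ nq qy'.
  suff -> : drop m p.2 = drop n q.2 by [].
  have sd : size (drop m p.2) = size (drop n q.2) by rewrite !size_drop; lia.
  have exy : bcat (drop m p.2) (sval x0) = bcat (drop n q.2) (sval x0) by rewrite -ex -ey.
  have := in_Z_cat_same dp sx; rewrite exy.
  by case/(in_Z_cat_eq dq sy sd).
have [x0 [px qy]] := pqg'.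
rewrite -(subnK pm) -(subnK (_ : size q.2 <= n)) ?iterD; last by lia.
rewrite (extends_shift px) (extends_shift qy); congr (iter _ _ _); lia.
Qed.

Lemma G_openE (S : grpd E -> Prop) g p q : G_open S -> S g ->
  cotail p q (gx (sval g)) (gy (sval g)) -> gk (sval g) = pdiff p q ->
  exists O, bE_open O /\ O (gy (sval g)) /\
    forall g', gk (sval g') = gk (sval g) -> O (gy (sval g')) ->
      cotail p q (gx (sval g')) (gy (sval g')) -> S g'.
Proof.
move=> oS /oS[Bs [bB [Bg BS]]] pq kpq.
have [O [oO [Oy OP]]] : exists O, bE_open O /\ O (gy (sval g)) /\
    forall g', gk (sval g') = gk (sval g) -> O (gy (sval g')) ->
      cotail p q (gx (sval g')) (gy (sval g')) -> forall B, List.In B Bs -> B g'.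
  elim: Bs bB Bg {BS} => [|B Bs IH] bB Bg; first by exists (fun _ => True); split=> //; apply: bE_openT.
  have [O [oO [Oy OP]]] := IH (fun B H => bB B (or_intror H)) (fun B H => Bg B (or_intror H)).
  have [O' [oO' [O'y OP']]] := G_basic_local (bB _ (or_introl erefl)) (Bg _ (or_introl erefl)) pq kpq.
  exists (fun z => O' z /\ O z); split; first exact: bE_openI.
  split=> // g' kg' [O'g' Og'] pqg' B' [<-|]; first exact: OP'.
  by apply: OP.
by exists O; do 2 split=> //; move=> g' kg' Og' pqg'; apply: BS; apply: OP.
Qed.

End Germs.

(** * Calculus of germs with degree *)

Section GermAlgebra.
Variable E : graph.
Local Notation rpath := (vtx E * seq (edg E))%type.
Implicit Types (v w : vtx E) (e : edg E) (l a b c t : seq (edg E)) (x y z : bE E).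
Implicit Types (p q r : rpath) (O : bE E -> Prop) (g h : bE E -> bE E) (k : int).

(** Near [y] the map [h] is the action of an open bisection through the arrow [(h y, k, y)]. *)
Definition germ h y k := exists p q O, bE_open O /\ O y /\ k = pdiff p q /\
  forall z, O z -> cotail p q (h z) z.

Lemma germ_continuous h y k O : germ h y k -> bE_open O -> O (h y) ->
  exists O', bE_open O' /\ O' y /\ forall z, O' z -> O (h z).
Proof.
move=> [p [q [U [oU [Uy [_ Uh]]]]]] oO Oy.
have [W [oW [Wy WP]]] := cotail_continuous (Uh _ Uy) oO Oy.
exists (fun z => U z /\ W z); split; first exact: bE_openI.
by split=> // z [/Uh pq /WP[x' [/(cotail_fun pq) <-]]].
Qed.

Lemma germ_cotail h y k : germ h y k -> exists p q, cotail p q (h y) y /\ k = pdiff p q.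
Proof. by move=> [p [q [O [_ [Oy [-> /(_ y Oy)]]]]]]; exists p, q. Qed.

Lemma germ_id y : germ id y 0%R.
Proof.
pose p := (bsrc (sval y), [::] : seq (edg E)).
exists p, p, (fun z => in_Z p.1 p.2 (sval z)); split; first exact: open_Z.
split; first exact/in_Z_nil; split; first by rewrite /pdiff; lia.
by move=> z /extends_Z[z0 pz]; exists z0.
Qed.

Lemma germ_ext h h' y k O : bE_open O -> O y -> (forall z, O z -> h z = h' z) ->
  germ h y k -> germ h' y k.
Proof.
move=> oO Oy hh' [p [q [U [oU [Uy [-> Uh]]]]]]; exists p, q, (fun z => O z /\ U z).
split; first exact: bE_openI.
by do 2 split=> //; move=> z [Oz Uz]; rewrite -hh' //; apply: Uh.
Qed.

Lemma germ_comp g h y k k' : germ g (h y) k -> germ h y k' -> germ (g \o h) y (k + k')%R.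
Proof.
move=> [p [q [O [oO [Oy [-> Og]]]]]] hy.
have [W [oW [Wy WP]]] := germ_continuous hy oO Oy.
have [q' [r [U [oU [Uy [-> Uh]]]]]] := hy.
have [p' [r' [<- pr]]] := cotail_comp (Og _ Oy) (Uh _ Uy).
exists p', r', (fun z => U z /\ W z); split; first exact: bE_openI.
by do 2 split=> //; move=> z [/Uh zU /WP/Og zO]; apply: pr zO zU.
Qed.

Lemma germ_inv h h' y k : cancel h h' -> germ h y k -> germ h' (h y) (- k)%R.
Proof.
move=> hK [p [q [O [oO [Oy [-> Oh]]]]]].
have [U [oU [Uy UP]]] := cotail_continuous (cotail_sym (Oh _ Oy)) oO Oy.
exists q, p, U; do 2 split=> //; split; first by rewrite /pdiff; lia.
move=> z /UP[y' [qp Oy']]; suff -> : z = h y' by rewrite hK; apply/cotail_sym/Oh.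
by apply: cotail_inj qp (cotail_sym (Oh _ Oy')).
Qed.

(** The longer pair of prefixes has the form [p t], [q t']. Equal degrees make [t] and [t'] equally
    long, and both begin the same tail; so they coincide, and the two replacements agree wherever
    both apply. *)
Lemma germ_agree g h y k : germ g y k -> germ h y k -> g y = h y ->
  exists O, bE_open O /\ O y /\ forall z, O z -> g z = h z.
Proof.
have le_case g1 h1 p p' q q' O O' : size p.2 <= size p'.2 -> pdiff p q = pdiff p' q' ->
    bE_open O -> O y -> bE_open O' -> O' y -> (forall z, O z -> cotail p q (g1 z) z) ->
    (forall z, O' z -> cotail p' q' (h1 z) z) -> g1 y = h1 y ->
    exists O, bE_open O /\ O y /\ forall z, O z -> g1 z = h1 z.
  move=> pp' d oO Oy oO' Oy' Og Oh ghy.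
  exists (fun z => O z /\ O' z); split; first exact: bE_openI.
  split=> // z [Oz Oz'].
  have [x0 [px qx]] := Og _ Oy; have [x1 [px1 qx1]] := Oh _ Oy'.
  have pZ : in_Z p.1 p.2 (sval (g1 y)) by apply/extends_Z; exists x0.
  have pZ' : in_Z p'.1 p'.2 (sval (g1 y)) by apply/extends_Z; exists x1; rewrite ghy.
  have qZ : in_Z q.1 q.2 (sval y) by apply/extends_Z; exists x0.
  have qZ' : in_Z q'.1 q'.2 (sval y) by apply/extends_Z; exists x1.
  have qq' : size q.2 <= size q'.2 by move: d; rewrite /pdiff; lia.
  have [e1 [t e2]] := in_Z_prefix pZ pZ' pp'; have [e3 [t' e4]] := in_Z_prefix qZ qZ' qq'.
  rewrite (surjective_pairing p') (surjective_pairing q') -e1 e2 -e3 e4 in px1 qx1 Oh.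
  have tt' : t = t'.
    have /extends_cat[y0 [py0 [pt [st et]]]] := px1; have /extends_cat[y1 [qy1 [pt' [st' et']]]] := qx1.
    have xy0 : x0 = y0 by rewrite -ghy in py0; apply: extends_inj px py0.
    have xy1 : x0 = y1 by apply: extends_inj qx qy1.
    have szt : size t = size t' by move: d; rewrite /pdiff e2 e4 !size_cat; lia.
    have := in_Z_cat_same pt st; rewrite -et -xy0 xy1 et' => /(in_Z_cat_eq pt' st' szt).
    by case.
  have [z0 [pz qz]] := Og _ Oz; have [z1 [/extends_cat[u [pu tu]] /extends_cat[u' [qu' tu']]]] := Oh _ Oz'.
  have e5 := extends_inj qz qu'; subst u' t'.
  suff e6 : u = z0 by rewrite e6 in pu; apply: extends_fun pz pu.
  by apply: bE_eq; have [_ [_ ->]] := tu; have [_ [_ ->]] := tu'.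
move=> [p [q [O [oO [Oy [-> Og]]]]]] [p' [q' [O' [oO' [Oy' [d Oh]]]]]] e.
have [pp|/ltnW pp] := leqP (size p.2) (size p'.2).
  exact: le_case pp d oO Oy oO' Oy' Og Oh e.
have [U [oU [Uy UP]]] := le_case _ _ _ _ _ _ _ _ pp (esym d) oO' Oy' oO Oy Oh Og (esym e).
by exists U; do 2 split=> //; move=> z /UP.
Qed.

End GermAlgebra.

(** * Uniqueness of degrees under Condition (L) *)

Section ConditionL.
Variable E : graph.
Hypotheses (EL : condL E) (ET : condT E).
Local Notation rpath := (vtx E * seq (edg E))%type.
Implicit Types (v w : vtx E) (e : edg E) (l a b c t : seq (edg E)) (x y z : bE E).
Implicit Types (p q r : rpath) (O : bE E -> Prop) (g h : bE E -> bE E) (k : int).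

(** Of two distinct paths from [v] at least one is nonempty. Hence there are no sinks, and every
    singular vertex is an infinite emitter. *)
Lemma condT_emits v : exists e, sc e = v.
Proof.
have [w [[|e l1] [[|e' l2] [p1 [_ [p2 [_ ne]]]]]]] := ET v => //.
- by exists e'; case: p2.
- by exists e; case: p1.
by exists e; case: p1.
Qed.

Lemma boundary_from v : exists x, bsrc (sval x) = v.
Proof.
have [nxt nxtP] := functional_choice _ condT_emits.
pose f n := nxt (iter n (fun w => rg (nxt w)) v).
have vf : bvalid (Inf f) by move=> i; rewrite /f /= nxtP.
by exists (exist _ (Inf f) vf); rewrite /= nxtP.
Qed.

Lemma Z_nonempty v l : is_path v l -> exists x, in_Z v l (sval x).
Proof.
move=> pl; have [x0 sx] := boundary_from (prange v l).
have [x px] := @extends_total _ (v, l) x0 pl sx.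
by exists x; apply/(@extends_Z _ (v, l)); exists x0.
Qed.

(** At a finite path, a neighbourhood excludes finitely many edges; since its range is an infinite
    emitter, some other edge prolongs it to a cylinder inside [O]. *)
Lemma open_contains_Z O x : bE_open O -> O x ->
  exists v l, is_path v l /\ forall z, in_Z v l (sval z) -> O z.
Proof.
move=> /bE_openP oO /oO[Ls LO].
case: x LO => [[v l|f] vx] LO /=.
  have [pl [sk|inf]] := vx; first by have [e] := condT_emits (prange v l); move/sk.
  have [F FP] := neighbourhood_finite Ls pl.
  have [e [se eF]] : exists e, sc e = prange v l /\ e \notin F.
    apply: NNPP => h; apply: inf; exists F => e se; apply/negPn/negP => eF.
    by apply: h; exists e.
  exists v, (rcons l e); rewrite -cats1 is_path_cat /=; split=> // z zle.
  apply: LO; apply: FP => [|f fF zlf]; first exact: in_Z_take zle.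
  rewrite -cats1 in zlf.
  have [|_] := (in_Z_determined _ zle (_ : size (l ++ [:: f]) <= _)).1 zlf.
    by rewrite !size_cat.
  rewrite take_oversize ?size_cat // => /eqP; rewrite eqseq_cat // => /andP[_ /eqP[fe]].
  by move: fF; rewrite fe (negPf eF).
have [n nP] := neighbourhood_infinite Ls f.
exists (sc (f 0)), [seq f i | i <- iota 0 n]; split; last by move=> z zn; apply: LO; apply: nP zn.
apply: (@in_Z_path _ _ _ (Inf f)) => //.
by split=> //; rewrite size_map size_iota.
Qed.

Lemma extends_power w d z n : extends (w, d) z z -> bsrc (sval z) = w ->
  extends (w, flatten (nseq n d)) z z.
Proof.
move=> dz zw; elim: n => [|n IH] //=.
apply/(@extends_cat _ (w, d)); exists z; split=> //=.
by have [_ [<- _]] := dz; rewrite zw.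
Qed.

(* If all paths of an open set had the form [c d d d], an exit of the cycle [d] would lead out. *)
Lemma no_period v c d O y : bE_open O -> O y -> size d > 0 ->
  ~ (forall z, O z -> exists z1, extends (v, c) z1 z /\ extends (prange v c, d) z1 z1).
Proof.
move=> /bE_openP oO Oy d0 per; set w := prange v c in per.
have [Ls LO] := oO _ Oy; have [y1 [cy dy]] := per _ Oy.
have [pd [sd _]] := dy; have [pc [yc _]] := cy; rewrite /= -/w in pc yc pd sd.
(* As [d] is nonempty, [n] copies of it are at least as long as every listed path, so the cylinder
   of [c ++ D] lies in [O]. *)
pose n := \max_(p <- Ls) size p.2; pose D := flatten (nseq n d).
have nD : n <= size D.
  by rewrite size_flatten /shape map_nseq sumn_nseq leq_pmull.
have ZO z : in_Z v (c ++ D) (sval z) -> O z.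
  move=> zD; apply: LO => w' k wk.
  have yD : in_Z v (c ++ D) (sval y).
    apply/(@extends_Z _ (v, c ++ D)); exists y1; apply/(@extends_cat _ (v, c)); exists y1.
    by split=> //; apply: extends_power.
  have kD : size k <= size (c ++ D).
    apply: leq_trans (_ : n <= _); last by rewrite size_cat; apply: leq_trans nD (leq_addl _ _).
    exact: (@leq_bigmax_seq _ Ls xpredT (fun p => size p.2) (w', k) wk isT).
  by rewrite (in_Z_determined _ zD kD) (in_Z_determined _ yD kD).
have wd : prange w d = w by rewrite -sd.
have [e [i [id [se ne]]]] := EL pd d0 wd.
have [pD rD] : is_path w D /\ prange w D = w.
  by have [pD [sD _]] := extends_power n dy yc; split=> //; exact: etrans (esym sD) yc.
have dE : d = take i d ++ nth e d i :: drop i.+1 d by rewrite -drop_nth // cat_take_drop.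
have [pt rt] : is_path w (take i d) /\ sc e = prange w (take i d).
  by move: (pd); rewrite {1}dE is_path_cat /= se => -[pt [-> _]].
(* This path follows the forced pattern up to the point where the exit [e] replaces the edge at
   position [i] of [d]. *)
have pDe : is_path w (D ++ rcons (take i d) e).
  by rewrite -cats1 !is_path_cat rD /=; do 3 (split=> //).
have [|z zZ] := @Z_nonempty v (c ++ (D ++ rcons (take i d) e)); first by rewrite is_path_cat.
have Oz : O z by apply: ZO; move: zZ; rewrite catA; apply: in_Z_take.
have [z1 [cz dz]] := per _ Oz; have [_ [sz ez]] := cz; rewrite /= -/w in sz.
move: zZ; rewrite ez (in_Z_cat _ pc sz) -/w => zZ.
have zZ' : in_Z w (D ++ d) (sval z1).
  apply/(@extends_Z _ (w, D ++ d)); exists z1; apply/(@extends_cat _ (w, D)); exists z1.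
  by rewrite /= rD; split=> //; apply: extends_power.
have sle : size (D ++ rcons (take i d) e) <= size (D ++ d).
  by rewrite !size_cat size_rcons leq_add2l size_takel // ltnW.
have [_] := (in_Z_determined _ zZ' sle).1 zZ.
rewrite take_cat size_cat ltnNge leq_addr /= addKn size_rcons size_takel ?(ltnW id) //.
move/eqP; rewrite eqseq_cat // eqxx /= (take_nth e) // eqseq_rcons eqxx /= => /eqP.
exact: ne.
Qed.

(** If [q] were [p d] with [d] nonempty, every tail would satisfy [z0 = d z0], against
    [no_period]. *)
Lemma same_length p q O y : bE_open O -> O y ->
  (forall z, O z -> exists z0, extends p z0 z /\ extends q z0 z) -> size p.2 = size q.2.
Proof.
have lt_case p1 q1 : bE_open O -> O y ->
    (forall z, O z -> exists z0, extends p1 z0 z /\ extends q1 z0 z) -> ~ size p1.2 < size q1.2.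
  move=> oO Oy per lt.
  have [y0 [py qy]] := per _ Oy.
  have pZ : in_Z p1.1 p1.2 (sval y) by apply/extends_Z; exists y0.
  have qZ : in_Z q1.1 q1.2 (sval y) by apply/extends_Z; exists y0.
  have [e1 [d e2]] := in_Z_prefix pZ qZ (ltnW lt).
  apply: (@no_period p1.1 p1.2 d O y) => //.
    by move: lt; rewrite e2 size_cat; lia.
  move=> z /per[z0 [pz]]; rewrite (surjective_pairing q1) -e1 e2 => /extends_cat[z1 [pz' dz]].
  by exists z0; rewrite -surjective_pairing; split=> //; rewrite -(extends_inj pz pz') in dz.
move=> oO Oy per; case: (ltngtP (size p.2) (size q.2)) => // [/(lt_case p q oO Oy per)//|].
by case/(lt_case q p oO Oy) => z /per[z0 []]; exists z0.
Qed.

(** With [p'] written as [p t], cancelling [p] shows that each [z] near [y] is both [q t z1] and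
    [q' z1]; so [same_length] applies to [q t] and [q']. *)
Lemma germ_unique h y k k' : germ h y k -> germ h y k' -> k = k'.
Proof.
have le_case p p' q q' O : size p.2 <= size p'.2 -> bE_open O -> O y ->
    (forall z, O z -> cotail p q (h z) z) -> (forall z, O z -> cotail p' q' (h z) z) ->
    pdiff p q = pdiff p' q'.
  move=> pp oO Oy Oh Oh'.
  have [x0 [px qx]] := Oh _ Oy; have [x1 [px1 qx1]] := Oh' _ Oy.
  have pZ : in_Z p.1 p.2 (sval (h y)) by apply/extends_Z; exists x0.
  have pZ' : in_Z p'.1 p'.2 (sval (h y)) by apply/extends_Z; exists x1.
  have [e1 [t e2]] := in_Z_prefix pZ pZ' pp.
  suff : size (q.1, q.2 ++ t).2 = size q'.2 by rewrite /= size_cat /pdiff e2 size_cat; lia.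
  apply: (same_length oO Oy) => z Oz; have [z0 [pz qz]] := Oh _ Oz.
  have [z1 [pz1 qz1]] := Oh' _ Oz; exists z1; split=> //.
  move: pz1; rewrite (surjective_pairing p') -e1 e2 => /extends_cat[z2 [pz2 tz]].
  apply/extends_cat; exists z0; split=> //.
  rewrite -(extends_inj pz pz2) in tz.
  by have [_ [<- _]] := qz; have [_ [-> _]] := pz.
move=> [p [q [O [oO [Oy [-> Oh]]]]]] [p' [q' [O' [oO' [Oy' [-> Oh']]]]]].
have oI := bE_openI oO oO'.
have [pp|/ltnW pp] := leqP (size p.2) (size p'.2).
  by apply: (le_case _ _ _ _ _ pp oI) => // z [] // ? ?; [apply: Oh | apply: Oh'].
by apply/esym; apply: (le_case _ _ _ _ _ pp oI) => // z [] // ? ?; [apply: Oh' | apply: Oh].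
Qed.

End ConditionL.

(** * The full group as a group of homeomorphisms *)

Section FullGroup.
Variable E : graph.
Hypotheses (EL : condL E) (ET : condT E).
Local Notation rpath := (vtx E * seq (edg E))%type.
Implicit Types (v w : vtx E) (e : edg E) (l a b c t : seq (edg E)) (x y z : bE E).
Implicit Types (p q r : rpath) (O : bE E -> Prop) (g h : bE E -> bE E) (k : int).

Lemma grpd_eq (u u' : grpd E) : gx (sval u) = gx (sval u') -> gk (sval u) = gk (sval u') ->
  gy (sval u) = gy (sval u') -> u = u'.
Proof.
case: u u' => [[x k y] P] [[x' k' y'] P'] /= ex ek ey; move: P'; rewrite -ex -ek -ey => P'.
by rewrite (proof_irrelevance _ P P').
Qed.

Lemma grpd_of_cotail p q x y : cotail p q x y ->
  exists u : grpd E, gx (sval u) = x /\ gk (sval u) = pdiff p q /\ gy (sval u) = y.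
Proof.
move=> pq; have G : inG (GTrip x (pdiff p q) y) by apply/inG_cotail; exists p, q.
by exists (exist _ _ G).
Qed.

Lemma grpd_of_germ h y k : germ h y k ->
  exists u : grpd E, gx (sval u) = h y /\ gk (sval u) = k /\ gy (sval u) = y.
Proof. by case/germ_cotail => p [q [/grpd_of_cotail + ->]]. Qed.

Definition moved h x := h x <> x.

(** For the converse the bisection consists of all arrows [(h y, k, y)] with [germ h y k]; that its
    arrows are determined by their endpoints is the uniqueness of degrees. *)
Lemma in_full_groupP h : in_full_group h <->
  bijective h /\ (forall y, exists k, germ h y k) /\ compact_wrt (@bE_open E) (closureB (moved h)).
Proof.
split=> [[U [[oU [Us [Ur [ty tx]]]] [hU cK]]]|[[h' hK h'K] [hg cK]]].
  split; [|split=> // y].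
    have [h' h'P] : exists h' : bE E -> bE E, forall x, h (h' x) = x.
      by apply: (functional_choice (fun x y => h y = x)) => x; have [u [Uu <-]] := tx x; exists (gy (sval u)); apply: hU.
    exists h' => // y; have [u [Uu uy]] := ty y; have [u' [Uu' uy']] := ty (h' (h y)).
    have [hu hu'] := (hU _ Uu, hU _ Uu'); rewrite uy in hu; rewrite uy' h'P in hu'.
    by rewrite -uy' -(Ur _ _ Uu Uu') ?uy // -hu -hu'.
  have [u [Uu uy]] := ty y; have [p [q [pq ku]]] := (inG_cotail _).1 (svalP u).
  have [O [oO [Oy OP]]] := G_openE oU Uu pq ku.
  have [O' [oO' [O'y OP']]] := cotail_continuous pq (@bE_openT E) Logic.I.
  exists (pdiff p q), p, q, (fun z => O z /\ O' z); split; first exact: bE_openI.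
  rewrite -uy; do 2 split=> //; move=> z [Oz /OP'[x' [pq' _]]].
  have [u' [u'x [u'k u'y]]] := grpd_of_cotail pq'.
  have /hU : U u' by apply: OP; rewrite ?ku ?u'y ?u'x.
  by rewrite u'x u'y => ->.
exists (fun u => germ h (gy (sval u)) (gk (sval u)) /\ gx (sval u) = h (gy (sval u))).
have uniq y k k' : germ h y k -> germ h y k' -> k = k' by apply: germ_unique.
split; last by split=> // u [].
split; [|split; [|split; [|split]]].
- apply: G_openI => u [[p [q [O [oO [Oy [uk Oh]]]]]] ux].
  exists p, q, O; do 2 split=> //; split; first by rewrite ux; apply: Oh.
  split=> // u' u'k Ou' pq'; rewrite u'k; split; first by exists p, q, O.
  exact: cotail_fun pq' (Oh _ Ou').
- move=> u u' [ug ux] [ug' ux'] e; apply: grpd_eq => //; first by rewrite ux ux' e.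
  by rewrite -e in ug'; apply: uniq ug ug'.
- move=> u u' [ug ux] [ug' ux'] e; have ey : gy (sval u) = gy (sval u').
    by apply: (can_inj hK); rewrite -ux -ux'.
  by apply: grpd_eq => //; rewrite -ey in ug'; apply: uniq ug ug'.
- move=> y; have [k hk] := hg y; have [u [ux [uk uy]]] := grpd_of_germ hk.
  by exists u; rewrite ux uk uy.
move=> x; have [k hk] := hg (h' x); have [u [ux [uk uy]]] := grpd_of_germ hk.
by exists u; rewrite ux uk uy h'K.
Qed.

Lemma compact_support_sub (h : bE E -> bE E) (K : bE E -> Prop) :
  compact_wrt (@bE_open E) K -> bE_open (fun x => ~ K x) -> (forall x, moved h x -> K x) ->
  compact_wrt (@bE_open E) (closureB (moved h)).
Proof.
move=> cK oK hK; apply: (compact_closed_sub cK); first exact: closureB_closed.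
exact: closureB_sub.
Qed.

Lemma full_group_comp g h : in_full_group g -> in_full_group h -> in_full_group (g \o h).
Proof.
move=> /in_full_groupP[gb [gg gK]] /in_full_groupP[hb [hg hK]]; apply/in_full_groupP.
split; first exact: bij_comp.
split=> [y|].
  have [k hk] := hg y; have [k' gk'] := gg (h y).
  by exists (k' + k)%R; apply: germ_comp.
apply: (compact_support_sub (compactU gK hK)).
  apply: (bE_open_ext (bE_openI (@closureB_closed E (moved g)) (@closureB_closed E (moved h)))) => x.
  by tauto.
move=> x ghx; have [hx|/NNPP hx] := classic (moved h x); first by right; apply: sub_closureB.
by left; apply: sub_closureB => e; apply: ghx; rewrite /= hx.
Qed.

Lemma full_group_inv g h : in_full_group g -> cancel g h -> cancel h g -> in_full_group h.
Proof.
move=> /in_full_groupP[gb [gg gK]] gh hg; apply/in_full_groupP; split; first by exists g.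
split=> [y|].
  by have [k gk] := gg (h y); exists (- k)%R; rewrite -(hg y); apply: germ_inv gh gk.
apply: (compact_support_sub gK); first exact: closureB_closed.
by move=> x hx; apply: sub_closureB => e; apply: hx; rewrite -{1}e gh.
Qed.

Lemma empty_compact (K : bE E -> Prop) : (forall x, ~ K x) -> compact_wrt (@bE_open E) K.
Proof. by move=> nK I O _ _; exists [::] => x /nK. Qed.

Lemma full_group_id : in_full_group (@id (bE E)).
Proof.
apply/in_full_groupP; split; first by exists id.
split=> [y|]; first by exists 0%R; apply: germ_id.
apply: empty_compact => x /(_ _ (@bE_openT E) Logic.I)[y [_]].
by apply.
Qed.

(** Two prefixes of [y] of the same length coincide, so the replacement is trivial. *)
Lemma cotail_id p q y z z' : size p.2 = size q.2 -> cotail p q y y -> cotail p q z z' -> z = z'.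
Proof.
move=> pq [y0 [py qy]] [z0 [pz qz]].
have pZ : in_Z p.1 p.2 (sval y) by apply/extends_Z; exists y0.
have qZ : in_Z q.1 q.2 (sval y) by apply/extends_Z; exists y0.
have qp : size q.2 <= size p.2 by rewrite pq.
have [e1 e2] := (in_Z_determined _ pZ qp).1 qZ.
rewrite -pq take_size in e2; rewrite (surjective_pairing q) e1 e2 -surjective_pairing in qz.
exact: extends_fun pz qz.
Qed.

(* At a fixed point of an involution the degree [k] of the germ satisfies [k + k = 0], so the
   germ is a unit. *)
Lemma involution_fixed_open h : in_full_group h -> (forall x, h (h x) = x) ->
  bE_open (fun x => h x = x).
Proof.
move=> /in_full_groupP[_ [hg _]] hh; apply: bE_open_local => x hx.
have [k hk] := hg x.
have k0 : k = 0%R.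
  have hkk : germ h (h x) k by rewrite hx.
  have := germ_ext (@bE_openT E) Logic.I (fun z _ => hh z) (germ_comp hkk hk).
  by move=> /(germ_unique EL ET)/(_ (germ_id x)); lia.
have [p [q [O [oO [Ox [kpq Oh]]]]]] := hk.
exists O; do 2 split=> //; move=> z /Oh; apply: (@cotail_id _ _ x).
  by move: kpq; rewrite k0 /pdiff; lia.
by move: (Oh _ Ox); rewrite hx.
Qed.

Lemma closed_agree (Ls : seq rpath) x : bE_open (fun z => ~ agree Ls (sval x) (sval z)).
Proof.
apply: bE_open_local => z nz; exists (fun z' => agree Ls (sval z) (sval z')).
split; first exact: open_agree.
split=> // z' zz' xz'; apply: nz; apply: agree_trans xz' _; exact: agree_sym.
Qed.

Lemma clopen_neighbourhood O x : bE_open O -> O x ->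
  exists A, bE_open A /\ bE_open (fun z => ~ A z) /\ A x /\ forall z, A z -> O z.
Proof.
move=> /bE_openP oO /oO[Ls LO]; exists (fun z => agree Ls (sval x) (sval z)).
by split; [apply: open_agree | split; [apply: closed_agree | split]].
Qed.

(** Exchange a clopen neighbourhood [A] of [y] with its image [B] near [x]; the clopen set [D] keeps
    the two disjoint. *)
Lemma swap_exists p q x y (Ox Oy : bE E -> Prop) : cotail p q x y -> x <> y ->
  bE_open Ox -> Ox x -> bE_open Oy -> Oy y ->
  exists h, in_full_group h /\ (forall z, h (h z) = z) /\ h y = x /\ germ h y (pdiff p q) /\
    forall z, h z <> z -> Ox z \/ Oy z.
Proof.
move=> pq xy oOx Oxx oOy Oyy.
have [D [oD [cD [Dx Dy]]]] := bE_separated xy.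
have [W [oW [Wy WP]]] := cotail_continuous pq (bE_openI oOx oD) (conj Oxx Dx).
have [A [oA [cA [Ay AP]]]] :=
  clopen_neighbourhood (bE_openI oW (bE_openI oOy cD)) (conj Wy (conj Oyy Dy)).
pose B u := exists z, A z /\ cotail p q u z.
have total_pq u : in_Z p.1 p.2 (sval u) -> exists z, cotail p q u z.
  move=> /extends_Z[u0 pu]; have [z0 [[_ [s _]] [qp [s' _]]]] := pq.
  have [|z qz] := @extends_total _ q u0 qp; last by exists z, u0.
  by have [_ [-> _]] := pu; rewrite -s.
have oB : bE_open B.
  apply: bE_open_local => u [z [Az pqu]].
  have [O [oO [Ou OP]]] := cotail_continuous (cotail_sym pqu) oA Az.
  by exists O; do 2 split=> //; move=> u' /OP[z' [/cotail_sym pq' Az']]; exists z'.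
(* No point outside the cylinder of [p] is in [B]. A point inside has a partner, as [p] and [q] have
   the same range, and the partners of nearby points stay outside [A]. *)
have cB : bE_open (fun u => ~ B u).
  apply: bE_open_local => u nBu; have [pu|npu] := classic (in_Z p.1 p.2 (sval u)); last first.
    exists (fun z => ~ in_Z p.1 p.2 (sval z)); split; first exact: closed_Z.
    by split=> // u' nu' [z [_ [z0 [pz _]]]]; apply: nu'; apply/extends_Z; exists z0.
  have [z pqz] := total_pq _ pu.
  have nAz : ~ A z by move=> Az; apply: nBu; exists z.
  have [O [oO [Ou OP]]] := cotail_continuous (cotail_sym pqz) cA nAz.
  exists O; do 2 split=> //; move=> u' /OP[z' [/cotail_sym pq' nAz']] [z2 [Az2 pq2]].
  by apply: nAz'; rewrite (cotail_inj pq' pq2).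
have AW z : A z -> exists u, cotail p q u z /\ Ox u /\ D u.
  by move=> /AP[/WP[u [pqu [Oxu Du]]] _]; exists u.
have BD u : B u -> D u /\ Ox u.
  by move=> [z [/AW[u' [pq' [? ?]]] pqu]]; rewrite (cotail_fun pqu pq').
have AB z : A z -> ~ B z by move=> /AP[_ [_ nD]] /BD[].
pose R z z' := (A z /\ cotail p q z' z) \/ (B z /\ cotail p q z z') \/ (~ A z /\ ~ B z /\ z' = z).
have [h hR] : exists h : bE E -> bE E, forall z, R z (h z).
  apply: (functional_choice R) => z; have [Az|nA] := classic (A z).
    by have [u [pqu _]] := AW _ Az; exists u; left.
  have [[u [Au pqu]]|nB] := classic (B z); last by exists z; right; right.
  by exists u; right; left; split=> //; exists u.
have hA z : A z -> cotail p q (h z) z by move=> Az; have := AB _ Az; have := hR z; rewrite /R; tauto.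
have hB z : B z -> cotail p q z (h z) by move=> Bz; have := fun Az => AB _ Az Bz; have := hR z; rewrite /R; tauto.
have hC z : ~ A z -> ~ B z -> h z = z by have := hR z; rewrite /R; tauto.
have hBA z : B z -> A (h z).
  by move=> Bz; have [z1 [Az1 pq1]] := Bz; rewrite (cotail_inj (hB _ Bz) pq1).
have hh z : h (h z) = z.
  have [Az|nA] := classic (A z).
    have Bh : B (h z) by exists z; split=> //; apply: hA.
    exact: cotail_inj (hB _ Bh) (hA _ Az).
  have [Bz|nB] := classic (B z); last by rewrite !hC.
  exact: cotail_fun (hA _ (hBA _ Bz)) (hB _ Bz).
have gA z : A z -> germ h z (pdiff p q) by exists p, q, A.
have mAB z : moved h z -> A z \/ B z by have := hC z; rewrite /moved; tauto.
have cAB : bE_open (fun z => ~ (A z \/ B z)).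
  by apply: (bE_open_ext (bE_openI cA cB)) => z; tauto.
exists h; split; last first.
  split=> //; split; first exact: cotail_fun (hA _ Ay) pq.
  split; first exact: gA.
  by move=> z /mAB[/AP|/BD]; tauto.
apply/in_full_groupP; split; first by exists h.
split=> [z|].
  have [Az|nA] := classic (A z); first by exists (pdiff p q); apply: gA.
  have [Bz|nB] := classic (B z).
    exists (pdiff q p), q, p, B; do 3 split=> //; move=> u Bu; apply: cotail_sym; exact: hB.
  exists 0%R; apply: (germ_ext (bE_openI cA cB) (conj nA nB)) (germ_id z).
  by move=> u [nAu nBu]; rewrite hC.
(* [A] and [B] are closed and each lies in one cylinder, so its points have a common source and
   [closed_compact] applies. *)
apply: (compact_support_sub _ cAB mAB); apply: compactU.
  apply: (closed_compact cA (v := q.1)) => z /AW[u [[u0 [_ qz]] _]].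
  by have [] : in_Z q.1 q.2 (sval z) by apply/extends_Z; exists u0.
apply: (closed_compact cB (v := p.1)) => z [u [_ [u0 [pz _]]]].
by have [] : in_Z p.1 p.2 (sval z) by apply/extends_Z; exists u0.
Qed.

Lemma full_group_restriction h (A : bE E -> Prop) : in_full_group h -> (forall x, h (h x) = x) ->
  bE_open A -> bE_open (fun x => ~ A x) -> (forall x, A x -> A (h x)) ->
  exists h', in_full_group h' /\ (forall x, A x -> h' x = h x) /\ (forall x, ~ A x -> h' x = x).
Proof.
move=> hf hh oA cA Ah; have /in_full_groupP[_ [hg hK]] := hf.
have [h' [h'A h'n]] : exists h' : bE E -> bE E,
    (forall x, A x -> h' x = h x) /\ (forall x, ~ A x -> h' x = x).
  have [h' hP] : exists h' : bE E -> bE E, forall x, (A x -> h' x = h x) /\ (~ A x -> h' x = x).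
    apply: (functional_choice (fun x y => (A x -> y = h x) /\ (~ A x -> y = x))) => x; have [Ax|nA] := classic (A x); first by exists (h x).
    by exists x.
  by exists h'; split=> x; have [] := hP x.
exists h'; split=> //; apply/in_full_groupP; split.
  suff h'K : cancel h' h' by exists h'.
  by move=> x; have [Ax|nA] := classic (A x); [rewrite !h'A //; apply: Ah | rewrite !h'n].
split=> [x|]; last first.
  apply: (compact_support_sub hK); first exact: closureB_closed.
  move=> x; rewrite /moved; have [Ax|nA] := classic (A x); last by rewrite h'n.
  by rewrite h'A // => ?; apply: sub_closureB.
have [Ax|nA] := classic (A x).
  by have [k hk] := hg x; exists k; apply: (germ_ext oA Ax) hk => z /h'A.
by exists 0%R; apply: (germ_ext cA nA) (germ_id x) => z /h'n.
Qed.

Lemma involution_compact h : in_full_group h -> (forall x, h (h x) = x) ->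
  compact_wrt (@bE_open E) (moved h).
Proof.
move=> hf hh; have /in_full_groupP[_ [_ hK]] := hf.
apply: (compact_closed_sub hK); last exact: sub_closureB.
by apply: (bE_open_ext (involution_fixed_open hf hh)) => x; rewrite /moved; tauto.
Qed.

End FullGroup.

(** * Orbits *)

Section Orbits.
Variable E : graph.
Local Notation rpath := (vtx E * seq (edg E))%type.
Implicit Types (v w : vtx E) (e g : edg E) (l a b c t : seq (edg E)) (x y z : bE E).
Implicit Types (p q r : rpath) (O : bE E -> Prop).

Definition orbit_equiv x y := exists p q, cotail p q x y.

Lemma orbit_sym x y : orbit_equiv x y -> orbit_equiv y x.
Proof. by move=> [p [q /cotail_sym]]; exists q, p. Qed.

Lemma orbit_trans x y z : orbit_equiv x y -> orbit_equiv y z -> orbit_equiv x z.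
Proof.
move=> [p [q pq]] [p' [r qr]]; have [p2 [r2 [_ /(_ _ _ _ pq qr)]]] := cotail_comp pq qr.
by exists p2, r2.
Qed.

Lemma orbit_refl x : orbit_equiv x x.
Proof. by have [p [q []]] := germ_cotail (germ_id x); exists p, q. Qed.

Lemma orbit_cons e x : rg e = bsrc (sval x) -> exists y, sval y = bcons e (sval x) /\ orbit_equiv x y.
Proof.
move=> ex; have [|y ey] := @extends_total _ (sc e, [:: e]) x _ (esym ex); first by split.
exists y; split; first by case: ey => _ [].
apply: orbit_sym; exists (sc e, [:: e]), (rg e, [::]); exists x; split=> //.
Qed.

Lemma orbit_shift x : exists y, sval y = shift (sval x) /\ orbit_equiv x y.
Proof.
have vs := valid_shift (svalP x); exists (exist _ _ vs); split=> //.
have [ge|lt] := classic (len_ge (sval x) 1).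
  have /inG_cotail[p [q []]] : inG (GTrip x 1%R (exist _ _ vs : bE E)); last by move=> pq _; exists p, q.
  by exists 1, 0; split=> //; split=> /=; [case: (shift _) | split].
(* [shift] leaves a path of length 0 unchanged. *)
suff -> : exist _ _ vs = x by apply: orbit_refl.
by apply: bE_eq => /=; case: (sval x) lt => [v [|e l]|f] //= [].
Qed.

Definition edge_at (x : bpath E) n : option (edg E) :=
  match x with
  | Fin _ l => onth l n
  | Inf f => Some (f n)
  end.

Lemma edge_at_cons e (x : bpath E) n : edge_at (bcons e x) n = if n is m.+1 then edge_at x m else Some e.
Proof. by case: x n => [v l|f] [|n]. Qed.

Lemma edge_at_neq x y n : edge_at (sval x) n <> edge_at (sval y) n -> x <> y.
Proof. by move=> h e; apply: h; rewrite e. Qed.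

Definition three_in_orbit x := exists y1 y2 y3, y1 <> y2 /\ y1 <> y3 /\ y2 <> y3 /\
  orbit_equiv x y1 /\ orbit_equiv x y2 /\ orbit_equiv x y3.

Lemma three_in_orbit_equiv x x' : orbit_equiv x x' -> three_in_orbit x' -> three_in_orbit x.
Proof.
move=> xx' [y1 [y2 [y3 [? [? [? [o1 [o2 o3]]]]]]]]; exists y1, y2, y3.
by do 3 split=> //; split; [|split]; apply: orbit_trans xx' _.
Qed.

Section NonDegenerate.
Hypotheses (ET : condT E) (EN : no_degenerate E).

(** The path repeats a loop [e]. Failure of degeneracy (1) gives another edge [g] into its vertex;
    then either there is a third one, or failure of (2) gives an edge into the source of [g].
    Prepending these edges yields the points. *)
Lemma three_in_orbit_const x : (forall n, edge_at (sval x) n.+1 = edge_at (sval x) n) ->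
  len_ge (sval x) 1 -> three_in_orbit x.
Proof.
case: x => [[v [|e l]|f] vx] // xc _.
  have xe n : onth (e :: l) n = Some e by elim: n => // n <-; apply: xc.
  by move: (xe (size l).+1); rewrite onth_default.
have fc n : f n = f 0 by elim: n => // n <-; have [] := xc n.
set e := f 0 in fc; set x : bE E := exist _ _ vx.
have re : rg e = sc e by rewrite -{2}(fc 1) -vx.
have xe n : edge_at (sval x) n = Some e by rewrite /= fc.
have [g [gv ge]] : exists g, rg g = sc e /\ g <> e.
  apply: NNPP => h; apply: (EN (v := sc e)); left; exists e; split=> // g.
  by split=> [gv|->//]; apply: NNPP => ge; apply: h; exists g.
have [y [yE oy]] := @orbit_cons g x gv.
have xy : x <> y by apply: (@edge_at_neq _ _ 0); rewrite xe yE edge_at_cons => -[/esym].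
have [[g' [g'v [g'e g'g]]]|n3] := classic (exists g', rg g' = sc e /\ g' <> e /\ g' <> g).
  have [z [zE oz]] := @orbit_cons g' x g'v.
  exists x, y, z; split=> //; split.
    by apply: (@edge_at_neq _ _ 0); rewrite xe zE edge_at_cons => -[/esym].
  split; last by split; [apply: orbit_refl | split].
  by apply: (@edge_at_neq _ _ 0); rewrite yE zE !edge_at_cons => -[/esym].
have [g' g'v] : exists g', rg g' = sc g.
  apply: NNPP => h; apply: (EN (v := sc e)); right; left; exists e, g; split.
    move=> g'; split=> [g'v|[->|->]//].
    by apply: NNPP => h'; apply: n3; exists g'; tauto.
  by split=> // g' g'v; apply: h; exists g'.
have [|z [zE oz]] := @orbit_cons g' y; first by rewrite yE bsrc_cons.
have xz : edge_at (sval z) 1 = Some g by rewrite zE edge_at_cons yE edge_at_cons.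
exists x, y, z; split=> //; split; first by apply: (@edge_at_neq _ _ 1); rewrite xe xz => -[/esym].
split; first by apply: (@edge_at_neq _ _ 1); rewrite xz yE edge_at_cons xe => -[/esym].
by split; [apply: orbit_refl | split=> //; apply: orbit_trans oy oz].
Qed.

(** The candidates are the path and its first two shifts. Coincidences make the path eventually
    constant or of period 2; in the latter case failure of degeneracy (3) allows an edge breaking
    the period to be prepended to the path or to its shift. *)
Lemma three_in_orbit_infinite f (vf : bvalid (Inf f)) : three_in_orbit (exist _ (Inf f) vf).
Proof.
set x : bE E := exist _ _ vf.
have [y [yE oy]] := orbit_shift x; have [z [zE oz]] := orbit_shift y.
have oxz := orbit_trans oy oz.
have [xy|xy] := classic (x = y).
  apply: three_in_orbit_const => // n.
  by rewrite {2}xy yE.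
have [yz|yz] := classic (y = z).
  apply: (three_in_orbit_equiv oy); apply: three_in_orbit_const; last by rewrite yE.
  by move=> n; rewrite {2}yz zE yE.
have [xz|xz] := classic (x = z); last by exists x, y, z; do 3 split=> //; split; [apply: orbit_refl | split].
have per n : f n.+2 = f n by move: (congr1 (fun x => edge_at (sval x) n) xz); rewrite zE yE /= => -[].
have f01 : f 0 <> f 1.
  move=> f01; apply: xy; apply: bE_eq; rewrite yE /=; congr Inf; apply: functional_extensionality.
  suff h n : f n = f n.+1 /\ f n.+1 = f n.+2 by move=> n; case: (h n).
  by elim: n => [|n [_ h2]]; split; rewrite ?per ?f01 ?h2 ?per.
have v0 : rg (f 0) = sc (f 1) by apply: vf.
have v1 : rg (f 1) = sc (f 0) by rewrite vf per.
have [g [gu|gu]] : exists g, (rg g = sc (f 0) /\ g <> f 1) \/ (rg g = sc (f 1) /\ g <> f 0).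
  apply: NNPP => h.
  have e0 g : rg g = sc (f 0) <-> g = f 1.
    by split=> [gv|->//]; apply: NNPP => gf; apply: h; exists g; left.
  have e1 g : rg g = sc (f 1) <-> g = f 0.
    by split=> [gv|->//]; apply: NNPP => gf; apply: h; exists g; right.
  apply: (EN (v := sc (f 0))); do 2 right; left; exists (sc (f 1)), (f 1), (f 0).
  split; first by move=> e; apply: f01; apply/e0; rewrite v0 e.
  split=> //; split; first by move=> g; rewrite e0; split=> [[]//|->].
  by split=> // g; rewrite e1; split=> [[]//|->].
- have [u [uE ou]] := @orbit_cons g x gu.1.
  exists x, y, u; split=> //; split.
    apply: (@edge_at_neq _ _ 1); rewrite uE edge_at_cons /= => -[]; exact/nesym.
  split; last by split; [apply: orbit_refl | split].
  by apply: (@edge_at_neq _ _ 0); rewrite uE edge_at_cons yE /= => -[] /esym/gu.2.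
have [|u [uE ou]] := @orbit_cons g y; first by rewrite yE /= gu.1.
exists x, y, u; split=> //; split.
  by apply: (@edge_at_neq _ _ 0); rewrite uE edge_at_cons /= => -[] /esym/gu.2.
split; last by split; [apply: orbit_refl | split=> //; apply: orbit_trans oy ou].
by apply: (@edge_at_neq _ _ 1); rewrite uE edge_at_cons yE /= per => -[].
Qed.

Lemma orbit_range v l (vx : bvalid (Fin v l)) (vy : bvalid (Fin (prange v l) [::])) :
  orbit_equiv (exist _ _ vx) (exist _ _ vy).
Proof.
exists (v, l), (prange v l, [::]); exists (exist _ _ vy); split; last by split.
case: vx => pl sg; split=> //; split=> //=; elim: l v pl {sg vy} => //= e l IH v [<- pl].
by rewrite -IH.
Qed.

(** A finite boundary path shares its orbit with the trivial path at its range, an infinite emitter;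
    failure of degeneracies (4) and (5) provides the edges to prepend there. *)
Lemma orbit_three x : three_in_orbit x.
Proof.
case: x => [[v l|f] vx]; last exact: three_in_orbit_infinite.
have [pl sg] := vx; set w := prange v l in sg.
have vw : bvalid (Fin w [::]) by [].
apply: (three_in_orbit_equiv (orbit_range vx vw)); set x : bE E := exist _ _ vw.
have inf : inf_emitter w by case: sg => // snk; have [e /snk] := condT_emits ET w.
have [e ew] : exists e, rg e = w.
  by apply: NNPP => h; apply: (EN (v := w)); do 3 right; left; split=> // e ew; apply: h; exists e.
have [y [yE oy]] := @orbit_cons e x ew.
have xy : x <> y by apply: (@edge_at_neq _ _ 0); rewrite yE edge_at_cons.
have [[g [gw ge]]|n2] := classic (exists g, rg g = w /\ g <> e).
  have [z [zE oz]] := @orbit_cons g x gw.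
  exists x, y, z; split=> //; split; first by apply: (@edge_at_neq _ _ 0); rewrite zE edge_at_cons.
  split; last by split; [apply: orbit_refl | split].
  by apply: (@edge_at_neq _ _ 0); rewrite yE zE !edge_at_cons => -[/esym].
have [g ge] : exists g, rg g = sc e.
  apply: NNPP => h; apply: (EN (v := w)); do 4 right; left; split=> //; exists e; split.
    by move=> g; split=> [gw|->//]; apply: NNPP => ge; apply: n2; exists g.
  by move=> g ge; apply: h; exists g.
have [|z [zE oz]] := @orbit_cons g y; first by rewrite yE bsrc_cons.
exists x, y, z; split=> //; split; first by apply: (@edge_at_neq _ _ 0); rewrite zE edge_at_cons.
split; last by split; [apply: orbit_refl | split=> //; apply: orbit_trans oy oz].
by apply: (@edge_at_neq _ _ 1); rewrite zE yE !edge_at_cons.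
Qed.

Lemma orbit_two x : exists y z, y <> x /\ z <> x /\ y <> z /\ orbit_equiv x y /\ orbit_equiv x z.
Proof.
have [y1 [y2 [y3 [n12 [n13 [n23 [o1 [o2 o3]]]]]]]] := orbit_three x.
have [e1|n1] := classic (y1 = x).
  by exists y2, y3; rewrite -{1 2}e1; do 2 (split; first exact: nesym).
have [e2|n2] := classic (y2 = x); last by exists y1, y2.
by exists y1, y3; split=> //; rewrite -{1}e2; split; first exact: nesym.
Qed.

End NonDegenerate.

(** * Parallel paths with disjoint cylinders *)

Section Branching.
Hypotheses (EL : condL E) (ET : condT E).

Definition disjoint_paths v a b := forall x, in_Z v a (sval x) -> ~ in_Z v b (sval x).

Lemma disjoint_paths_cat v a b c d : disjoint_paths v a b -> disjoint_paths v (a ++ c) (b ++ d).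
Proof. by move=> dis x /in_Z_take/dis nb /in_Z_take. Qed.

Lemma disjoint_paths_prepend v l a b : disjoint_paths (prange v l) a b ->
  disjoint_paths v (l ++ a) (l ++ b).
Proof.
move=> dis x la; have /(in_ZP _ _ (svalP x))[x0 [pl [sx ex]]] := in_Z_take la.
move: la; rewrite ex !(in_Z_cat _ pl sx); exact: dis.
Qed.

(** If the two paths given by (T) have a common extension, one is a prefix of the other and the
    surplus is a cycle at their end. Leaving it by an exit at once, or after one additional turn,
    gives paths with the same range that part at the exit. *)
Lemma branching v : exists w a b, is_path v a /\ prange v a = w /\ is_path v b /\ prange v b = w /\
  disjoint_paths v a b.
Proof.
have [w [l1 [l2 [p1 [r1 [p2 [r2 ne]]]]]]] := ET v.
have [dis|] := classic (disjoint_paths v l1 l2); first by exists w, l1, l2.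
move=> /not_all_ex_not[x ndis].
have {ndis}[x1 x2] : in_Z v l1 (sval x) /\ in_Z v l2 (sval x) by tauto.
have [l [d [pl [rl [pd [rd d0]]]]]] : exists l d, is_path v l /\ prange v l = w /\
    is_path w d /\ prange w d = w /\ size d > 0.
  have cyc l l' : is_path v l -> prange v l = w -> is_path v l' -> prange v l' = w -> l <> l' ->
      (exists t, l' = l ++ t) -> exists l d, is_path v l /\ prange v l = w /\
      is_path w d /\ prange w d = w /\ size d > 0.
    move=> pl rl pl' rl' ll' [[|e t] et]; first by rewrite cats0 in et; case: ll'.
    exists l, (e :: t); move: pl' rl'; rewrite et is_path_cat prange_cat rl => -[_ pt] rt.
    by do 4 split=> //.
  have [ss|/ltnW ss] := leqP (size l1) (size l2).
    by apply: (cyc l1 l2) => //; have [] := in_Z_prefix x1 x2 ss.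
  by apply: (cyc l2 l1) => //; [exact: nesym | have [] := in_Z_prefix x2 x1 ss].
have [e [i [id [se nee]]]] := EL pd d0 rd.
have dE : d = take i d ++ nth e d i :: drop i.+1 d by rewrite -drop_nth // cat_take_drop.
have [pt rt] : is_path w (take i d) /\ sc e = prange w (take i d).
  by move: (pd); rewrite {1}dE is_path_cat /= se => -[pt [st _]].
have pe : is_path w (rcons (take i d) e) by rewrite -cats1 is_path_cat /=.
exists (rg e), (l ++ rcons (take i d) e), (l ++ (d ++ rcons (take i d) e)).
have re : prange w (rcons (take i d) e) = rg e by rewrite -cats1 prange_cat.
split; first by rewrite is_path_cat rl.
split; first by rewrite prange_cat rl.
split; first by rewrite !is_path_cat rl rd.
split; first by rewrite !prange_cat rl rd.
apply: disjoint_paths_prepend; rewrite rl => z zt /in_Z_take zd.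
have sle : size (rcons (take i d) e) <= size d by rewrite size_rcons size_takel // ltnW.
have [_] := (in_Z_determined _ zd sle).1 zt.
rewrite size_rcons size_takel ?(ltnW id) // (take_nth e) // => /eqP.
by rewrite eqseq_rcons eqxx => /eqP.
Qed.

Lemma open_three_in_orbit O x : bE_open O -> O x -> exists y1 y2 y3,
  O y1 /\ O y2 /\ O y3 /\ y1 <> y2 /\ y1 <> y3 /\ y2 <> y3 /\
  orbit_equiv y1 y2 /\ orbit_equiv y2 y3.
Proof.
move=> oO Ox; have [v [l [pl lO]]] := open_contains_Z ET oO Ox.
have [w [a [b [pa [ra [pb [rb dab]]]]]]] := branching (prange v l).
(* Two successive branchings give the three continuations [a ++ c], [a ++ d] and [b ++ c] of [l],
   all followed by one tail [y0]. *)
have [u [c [d [pc [rc [pd [rd dcd]]]]]]] := branching w.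
have [y0 y0u] := boundary_from ET u.
have ext m : is_path (prange v l) m -> prange (prange v l) m = u ->
    exists y, in_Z v (l ++ m) (sval y) /\ extends (v, l ++ m) y0 y.
  move=> pm rm; have [||y ey] := @extends_total _ (v, l ++ m) y0.
  - by rewrite /= is_path_cat.
  - by rewrite /= prange_cat rm.
  by exists y; split=> //; apply/(@extends_Z _ (v, l ++ m)); exists y0.
have [||y1 [z1 e1]] := ext (a ++ c); rewrite ?is_path_cat ?prange_cat ?ra //.
have [||y2 [z2 e2]] := ext (a ++ d); rewrite ?is_path_cat ?prange_cat ?ra //.
have [||y3 [z3 e3]] := ext (b ++ c); rewrite ?is_path_cat ?prange_cat ?rb //.
have inO m y : in_Z v (l ++ m) (sval y) -> O y by move=> /in_Z_take/lO.
have neq m m' y y' : disjoint_paths (prange v l) m m' -> in_Z v (l ++ m) (sval y) ->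
    in_Z v (l ++ m') (sval y') -> y <> y'.
  by move=> /disjoint_paths_prepend dis zy zy' e; apply: (dis y) => //; rewrite e.
exists y1, y2, y3; do 3 (split; first by apply: inO; eassumption).
split; first by apply: neq z1 z2; apply: disjoint_paths_prepend; rewrite ra.
split; first by apply: neq z1 z3; apply: disjoint_paths_cat.
split; first by apply: neq z2 z3; apply: disjoint_paths_cat.
by split; do 2 eexists; exists y0; split; eassumption.
Qed.

End Branching.
End Orbits.

(** * Groupoids and their full groups *)

Section FullGroupAction.
Variable E : graph.
Hypotheses (EL : condL E) (ET : condT E) (EN : no_degenerate E).
Implicit Types (x y z : bE E) (O : bE E -> Prop) (g h : full_group E).

Lemma full_group_ext g h : sval g =1 sval h -> g = h.
Proof.
case: g h => [g Pg] [h Ph] /= /functional_extensionality e; move: Ph; rewrite -e => Ph.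
by rewrite (proof_irrelevance _ Pg Ph).
Qed.

Definition full_mul g h : full_group E :=
  exist _ (sval g \o sval h) (full_group_comp EL ET (svalP g) (svalP h)).

Definition full_one : full_group E := exist _ id (full_group_id EL ET).

Lemma full_inv_exists g : exists h, cancel (sval g) (sval h) /\ cancel (sval h) (sval g).
Proof.
have /(in_full_groupP EL ET)[[h gh hg] _] := svalP g.
by exists (exist _ h (full_group_inv EL ET (svalP g) gh hg)).
Qed.

Definition full_inv g := sval (constructive_indefinite_description _ (full_inv_exists g)).

Lemma full_invK g : cancel (sval g) (sval (full_inv g)) /\ cancel (sval (full_inv g)) (sval g).
Proof. exact: svalP (constructive_indefinite_description _ (full_inv_exists g)). Qed.

Lemma full_involution g : full_mul g g = full_one <-> forall x, sval g (sval g x) = x.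
Proof.
split=> [gg x|gg]; first by rewrite -[RHS]/(sval full_one x) -gg.
exact: full_group_ext.
Qed.

Lemma full_continuous g : continuous_wrt (@bE_open E) (@bE_open E) (sval g).
Proof.
move=> O oO; have /(in_full_groupP EL ET)[_ [gg _]] := svalP g.
apply: bE_open_local => x Ogx; have [k gk] := gg x.
by have [O' [oO' [O'x OP]]] := germ_continuous gk oO Ogx; exists O'.
Qed.

Lemma swap_in_open x y O : orbit_equiv x y -> x <> y -> bE_open O -> O x -> O y ->
  exists g, (forall z, sval g (sval g z) = z) /\ sval g x = y /\ sval g y = x /\
    forall z, sval g z <> z -> O z.
Proof.
move=> [p [q pq]] xy oO Ox Oy.
have [h [hf [hh [hy [_ hO]]]]] := swap_exists EL ET pq xy oO Ox oO Oy.
exists (exist _ h hf); split=> //=; split; first by rewrite -hy hh.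
by split=> // z /hO[].
Qed.

Lemma open_neq y : bE_open (fun z => z <> y).
Proof.
apply: bE_open_local => x xy; have [A [oA [_ [Ax nA]]]] := bE_separated xy.
by exists A; do 2 split=> //; move=> z Az e; apply: nA; rewrite -e.
Qed.

(** Swaps of [y1], [y2] and of [y2], [y3], each fixing the remaining point, compose to a 3-cycle. *)
Lemma full_local_nonsquare O x : bE_open O -> O x ->
  exists g y, (forall z, sval g z <> z -> O z) /\ sval g (sval g y) <> y.
Proof.
move=> oO Ox.
have [y1 [y2 [y3 [O1 [O2 [O3 [n12 [n13 [n23 [o12 o23]]]]]]]]]] := open_three_in_orbit EL ET oO Ox.
have [a [aa [a1 [a2 aO]]]] := swap_in_open o12 n12 (bE_openI oO (@open_neq y3)) (conj O1 n13) (conj O2 n23).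
have [b [bb [b2 [b3 bO]]]] := swap_in_open o23 n23 (bE_openI oO (@open_neq y1))
  (conj O2 (nesym n12)) (conj O3 (nesym n13)).
have a3 : sval a y3 = y3 by apply: NNPP => /aO[].
exists (full_mul b a), y1; split=> /= [z|]; last by rewrite a1 b2 a3 b3; apply: nesym.
have [e|/aO[]//] := classic (sval a z = z).
by rewrite e => /bO[].
Qed.

Lemma full_local_involution O x : bE_open O -> O x ->
  exists g, full_mul g g = full_one /\ g <> full_one /\ (forall z, sval g z <> z -> O z).
Proof.
move=> oO Ox.
have [y1 [y2 [y3 [O1 [O2 [_ [n12 [_ [_ [o12 _]]]]]]]]]] := open_three_in_orbit EL ET oO Ox.
have [a [aa [a1 [a2 aO]]]] := swap_in_open o12 n12 oO O1 O2.
exists a; split; first exact/full_involution; split=> // e.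
by apply: n12; rewrite -a1 e.
Qed.

(** The partners [y] and [z] of [x] may lie outside [O]; there one swap moves points of [D] only and
    the other points of its complement only. *)
Lemma full_involution_subbasis O x : bE_open O -> O x ->
  exists g h, full_mul g g = full_one /\ full_mul h h = full_one /\
    sval g x <> x /\ sval h x <> x /\ forall z, sval g z <> z -> sval h z <> z -> O z.
Proof.
move=> oO Ox; have [y [z [yx [zx [yz [oy oz]]]]]] := orbit_two ET EN x.
have [D [oD [cD [Dy Dz]]]] := bE_separated yz.
have [g [gg [gx [_ gO]]]] := swap_in_open oy (nesym yx) (bE_openU oO oD) (or_introl Ox) (or_intror Dy).
have [h [hh [hx [_ hO]]]] := swap_in_open oz (nesym zx) (bE_openU oO cD) (or_introl Ox) (or_intror Dz).
exists g, h; rewrite !full_involution gx hx; do 4 split=> //.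
by move=> w /gO[//|Dw] /hO[].
Qed.

Definition full_action : action := {|
  pt := bE E;
  aopen := @bE_open E;
  gr := full_group E;
  act := fun g => sval g;
  amul := full_mul;
  aone := full_one;
  ainv := full_inv;
  act_mul := fun _ _ _ => erefl;
  act_one := fun _ => erefl;
  act_invK := fun g => (full_invK g).1;
  act_invKV := fun g => (full_invK g).2;
  act_faithful := full_group_ext;
  act_continuous := full_continuous;
  aopenI := @bE_openI E;
  aopen_local := @bE_open_local E;
  separated := @bE_separated E;
  fixed_open := fun g gg =>
    involution_fixed_open EL ET (svalP g) ((full_involution g).1 gg);
  moved_compact := fun g gg =>
    involution_compact EL ET (svalP g) ((full_involution g).1 gg);
  restriction := fun g A gg oA cA gA =>
    let: ex_intro h (conj hf hA) :=
      full_group_restriction EL ET (svalP g) ((full_involution g).1 gg) oA cA gA in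
    ex_intro _ (exist _ h hf) hA;
  local_nonsquare := full_local_nonsquare;
  local_involution := full_local_involution;
  involution_subbasis := full_involution_subbasis
|}.

(* An element with equal range and source [x] is factored through another point of the orbit
   of [x], since a swap only realizes elements joining distinct points. *)
Lemma germ_realization (a : grpd E) : exists h,
  germ (sval h) (gy (sval a)) (gk (sval a)) /\ gx (sval a) = sval h (gy (sval a)).
Proof.
have [p [q [pq ka]]] := (inG_cotail _).1 (svalP a); rewrite ka.
have swap r s x y : cotail r s x y -> x <> y ->
    exists h, sval h y = x /\ germ (sval h) y (pdiff r s).
  move=> rs xy.
  have [h [hf [_ [hy [hg _]]]]] := swap_exists EL ET rs xy (@bE_openT E) Logic.I (@bE_openT E) Logic.I.
  by exists (exist _ h hf).
have [e|xy] := classic (gx (sval a) = gy (sval a)); last first.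
  by have [h [hy hg]] := swap _ _ _ _ pq xy; exists h.
rewrite e in pq *; set x := gy (sval a) in pq *.
have [z [_ [zx [_ [_ [[r [s rs]] _]]]]]] := orbit_two ET EN x.
have [p2 [q2 [k2 /(_ _ _ _ (cotail_sym rs) pq) pq2]]] := cotail_comp (cotail_sym rs) pq.
have [h1 [h1z g1]] := swap _ _ _ _ rs (nesym zx).
have [h2 [h2x g2]] := swap _ _ _ _ pq2 zx.
exists (full_mul h1 h2); rewrite /= h2x h1z; split=> //.
have -> : pdiff p q = (pdiff r s + pdiff p2 q2)%R by rewrite k2 /pdiff; lia.
by apply: germ_comp g2; rewrite h2x.
Qed.

End FullGroupAction.

(** * From a homeomorphism of unit spaces to the groupoids *)

Section GermTransfer.
Variables E F : graph.
Hypotheses (EL : condL E) (ET : condT E) (EN : no_degenerate E) (FL : condL F) (FT : condT F).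
Variables (phi : full_group E -> full_group F) (u : bE E -> bE F) (v : bE F -> bE E).
Hypotheses (uK : cancel u v) (vK : cancel v u).
Hypotheses (u_cont : continuous_wrt (@bE_open E) (@bE_open F) u).
Hypotheses (v_cont : continuous_wrt (@bE_open F) (@bE_open E) v).
Hypothesis u_equi : forall g x, u (sval g x) = sval (phi g) (u x).

Definition same_germ (a : grpd E) (b : grpd F) := exists h,
  germ (sval h) (gy (sval a)) (gk (sval a)) /\ gx (sval a) = sval h (gy (sval a)) /\
  germ (sval (phi h)) (gy (sval b)) (gk (sval b)) /\
  gy (sval b) = u (gy (sval a)) /\ gx (sval b) = u (gx (sval a)).

(** Elements with the same germ agree near the point, so by equivariance their images under [phi]
    agree near its image; degrees are unique in [F]. *)
Lemma same_germ_fun a b b' : same_germ a b -> same_germ a b' -> b = b'.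
Proof.
move=> [h [ha [xa [hb [yb xb]]]]] [h' [ha' [xa' [hb' [yb' xb']]]]].
apply: grpd_eq; rewrite ?xb ?yb //.
have [O [oO [Oy OP]]] := germ_agree ha ha' (etrans (esym xa) xa').
have Ov : O (v (gy (sval b))) by rewrite yb uK.
have hbb : germ (sval (phi h')) (gy (sval b)) (gk (sval b)).
  apply: (germ_ext (v_cont oO) Ov) hb => z Oz.
  by rewrite -(vK z) -!u_equi OP.
by rewrite yb' -yb in hb'; apply: germ_unique FL FT _ _ _ _ hbb hb'.
Qed.

Lemma same_germ_of h y k k' : germ (sval h) y k -> germ (sval (phi h)) (u y) k' ->
  exists b : grpd F, [/\ gx (sval b) = u (sval h y), gk (sval b) = k' & gy (sval b) = u y] /\
    forall a, gx (sval a) = sval h y -> gk (sval a) = k -> gy (sval a) = y -> same_germ a b.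
Proof.
move=> hy hu; have [b [bx [bk by_]]] := grpd_of_germ hu.
exists b; split; first by split=> //; rewrite bx u_equi.
by move=> a ax ak ay; exists h; rewrite ax ak ay bx bk by_ u_equi.
Qed.

Lemma same_germ_exists a : exists b, same_germ a b.
Proof.
have [h [ha ax]] := germ_realization EL ET EN a.
have /(in_full_groupP FL FT)[_ [/(_ (u (gy (sval a))))[k hk] _]] := svalP (phi h).
by have [b [_ /(_ a ax erefl erefl)]] := same_germ_of ha hk; exists b.
Qed.

(** A single [h] represents all arrows in a slice through [a], and a single pair [p'], [q']
    describes [phi h] above it; so the slice is mapped into the slice of [p'], [q'] through
    [f a]. *)
Lemma same_germ_continuous (f : grpd E -> grpd F) : (forall a, same_germ a (f a)) ->
  continuous_wrt (@G_open E) (@G_open F) f.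
Proof.
move=> fP S oS; apply: G_openI => a Sfa.
have [h [ha [ax [hb [yb xb]]]]] := fP a.
have [p [q [O0 [oO0 [O0y [ka O0h]]]]]] := ha.
have [p' [q' [O1 [oO1 [O1y [kb O1h]]]]]] := hb.
have pq' : cotail p' q' (gx (sval (f a))) (gy (sval (f a))).
  by rewrite xb ax u_equi -yb; apply: O1h.
have [O2 [oO2 [O2y O2P]]] := G_openE oS Sfa pq' kb.
exists p, q, (fun z => O0 z /\ O1 (u z) /\ O2 (u z)).
split; first by apply: bE_openI => //; apply: bE_openI; apply: u_cont.
split; first by rewrite -yb.
split; first by rewrite ax; apply: O0h.
split=> // a' ka' [O0a [O1a O2a]] pqa.
have ax' : gx (sval a') = sval h (gy (sval a')) := cotail_fun pqa (O0h _ O0a).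
have hz : germ (sval h) (gy (sval a')) (gk (sval a)) by exists p, q, O0.
have hu : germ (sval (phi h)) (u (gy (sval a'))) (gk (sval (f a))) by exists p', q', O1.
have [b [[bx bk by_] bP]] := same_germ_of hz hu.
rewrite (same_germ_fun (fP a') (bP a' ax' ka' erefl)).
by apply: O2P; rewrite // ?by_ // bx u_equi; apply: O1h.
Qed.

Hypothesis phiM : forall g h k : full_group E, sval k = sval g \o sval h ->
  sval (phi k) = sval (phi g) \o sval (phi h).

Lemma same_germ_prod (f : grpd E -> grpd F) a b c : (forall a, same_germ a (f a)) ->
  gprod a b c -> gprod (f a) (f b) (f c).
Proof.
move=> fP [ab [cx [ck cy]]].
have [ha [ga [ax [gfa [yfa xfa]]]]] := fP a; have [hb [gb [bx [gfb [yfb xfb]]]]] := fP b.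
have [hc [gc [cx' [gfc [yfc xfc]]]]] := fP c.
split; first by rewrite yfa xfb ab.
split; first by rewrite xfc xfa cx.
split; last by rewrite yfc yfb cy.
pose hab := full_mul EL ET ha hb.
have g1 : germ (sval hab) (gy (sval b)) (gk (sval a) + gk (sval b))%R.
  by apply: germ_comp gb; rewrite -bx -ab.
have g2 : germ (sval (phi hab)) (u (gy (sval b))) (gk (sval (f a)) + gk (sval (f b)))%R.
  rewrite (phiM (g := ha) (h := hb)) //; rewrite -yfb; apply: germ_comp gfb.
  by rewrite yfb -u_equi -bx -ab -yfa.
have [d [[dx dk dy] dP]] := same_germ_of g1 g2.
have -> : f c = d; last by [].
apply: same_germ_fun (fP c) (dP c _ ck cy).
by rewrite cx ax ab bx.
Qed.

End GermTransfer.

Lemma same_germ_sym (E F : graph) (phi : full_group E -> full_group F)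
    (psi : full_group F -> full_group E) (u : bE E -> bE F) (v : bE F -> bE E) a b :
  cancel phi psi -> cancel u v -> (forall g x, u (sval g x) = sval (phi g) (u x)) ->
  same_germ phi u a b -> same_germ psi v b a.
Proof.
move=> phiK uK ue [h [ha [ax [hb [yb xb]]]]]; exists (phi h).
split=> //; split; first by rewrite xb yb ax ue.
by rewrite phiK xb yb !uK.
Qed.

Lemma full_iso_grpd_iso (E F : graph) :
  condL E -> condT E -> no_degenerate E -> condL F -> condT F -> no_degenerate F ->
  full_group_iso E F -> grpd_iso E F.
Proof.
move=> EL ET EN FL FT FN [phi [phi_bij phiM]].
have [psi phiK psiK] := phi_bij.
have mulM a b : phi (full_mul EL ET a b) = full_mul FL FT (phi a) (phi b).
  by apply: full_group_ext => y /=; rewrite (phiM a b).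
have [u [v [uK [vK [uc [vc ue]]]]]] :=
  @spatial_realization (full_action EL ET EN) (full_action FL FT FN) phi phi_bij mulM.
have ve g y : v (sval g y) = sval (psi g) (v y).
  by apply: (can_inj uK); rewrite [RHS]ue psiK !vK.
have psiM (g h k : full_group F) : sval k = sval g \o sval h ->
    sval (psi k) = sval (psi g) \o sval (psi h).
  move=> kE; suff -> : psi k = full_mul EL ET (psi g) (psi h) by [].
  apply: (can_inj phiK); rewrite mulM !psiK; apply: full_group_ext => y.
  by rewrite kE.
have [f fP] := functional_choice _ (same_germ_exists EL ET EN FL FT ue).
have [g gP] := functional_choice _ (same_germ_exists FL FT FN EL ET ve).
have fK : cancel f g.
  by move=> a; apply: (same_germ_fun EL ET vK uK uc ve (gP _)); apply: same_germ_sym ue (fP a).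
have gK : cancel g f.
  by move=> b; apply: (same_germ_fun FL FT uK vK vc ue (fP _)); apply: same_germ_sym ve (gP b).
exists f, g; do 2 split=> //; split; first exact (same_germ_continuous FL FT uK vK uc vc ue fP).
split; first exact (same_germ_continuous EL ET vK uK vc uc ve gP).
move=> a b c; split.
  exact: (same_germ_prod EL ET FL FT uK vK vc ue phiM fP).
by move=> /(same_germ_prod FL FT EL ET vK uK uc ve psiM gP); rewrite !fK.
Qed.

(** * From a groupoid isomorphism to the full groups *)

Section UnitMap.
Variables E F : graph.
Variable f : grpd E -> grpd F.
Hypothesis fM : forall a b c, gprod a b c -> gprod (f a) (f b) (f c).

Lemma inG_unit (H : graph) (x : bE H) : inG (GTrip x 0%R x).
Proof. by exists 0, 0; case: (sval x). Qed.

Definition unit_at (H : graph) (x : bE H) : grpd H := exist _ _ (inG_unit x).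

Definition unit_map x := gx (sval (f (unit_at x))).

(** A unit is idempotent, so the degree of its image satisfies [k = k + k]. *)
Lemma unit_mapE x : f (unit_at x) = unit_at (unit_map x).
Proof.
have /fM[yx [_ [kk _]]] : gprod (unit_at x) (unit_at x) (unit_at x) by [].
by apply: grpd_eq => //=; move: kk; lia.
Qed.

Lemma gx_unit_map a : gx (sval (f a)) = unit_map (gx (sval a)).
Proof.
have /fM : gprod (unit_at (gx (sval a))) a a by do 2 split=> //=; rewrite GRing.add0r.
by rewrite unit_mapE => -[].
Qed.

Lemma gy_unit_map a : gy (sval (f a)) = unit_map (gy (sval a)).
Proof.
have /fM : gprod a (unit_at (gy (sval a))) a by do 2 split=> //=; rewrite GRing.addr0.
by rewrite unit_mapE => -[].
Qed.

Lemma unit_map_continuous : continuous_wrt (@G_open E) (@G_open F) f ->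
  continuous_wrt (@bE_open E) (@bE_open F) unit_map.
Proof.
move=> fc O oO.
have oS : G_open (fun b : grpd F => O (gx (sval b))).
  apply: G_openI => b Ob; have [p [q [pq kb]]] := (inG_cotail _).1 (svalP b).
  have [O' [oO' [O'y OP]]] := cotail_continuous pq oO Ob.
  exists p, q, O'; do 4 split=> //; move=> b' _ /OP[x' [pq' Ox']] pqb.
  by rewrite (cotail_fun pqb pq').
apply: bE_open_local => x Ox.
have [p [q [pq k0]]] := germ_cotail (germ_id x).
have [O' [oO' [O'y OP]]] := @G_openE _ _ (unit_at x) p q (fc _ oS) Ox pq k0.
(* The units near [x] must lie in the slice of [p], [q]. These have equal lengths, so [cotail_id]
   makes each nearby point its own partner. *)
have [O2 [oO2 [O2x idP]]] : exists O2, bE_open O2 /\ O2 x /\ forall z, O2 z -> cotail p q z z.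
  have [O2 [oO2 [O2x OP2]]] := cotail_continuous pq (@bE_openT E) Logic.I.
  exists O2; do 2 split=> //; move=> z /OP2[z' [pq' _]].
  suff e : z' = z by rewrite -{1}e.
  by apply: (cotail_id _ pq pq'); move: k0; rewrite /pdiff; lia.
exists (fun z => O' z /\ O2 z); split; first exact: bE_openI.
by split=> // z [O'z /idP pqz]; apply: (OP (unit_at z)).
Qed.

End UnitMap.

Lemma unit_mapK (E F : graph) (f : grpd E -> grpd F) (g : grpd F -> grpd E) : cancel f g ->
  (forall a b c, gprod a b c -> gprod (f a) (f b) (f c)) -> cancel (unit_map f) (unit_map g).
Proof. by move=> fK fM x; rewrite {1}/unit_map -unit_mapE // fK. Qed.

Section TransportFullGroup.
Variables (E F : graph) (f : grpd E -> grpd F) (g : grpd F -> grpd E).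
Hypotheses (fK : cancel f g) (gK : cancel g f).
Hypotheses (f_cont : continuous_wrt (@G_open E) (@G_open F) f).
Hypotheses (g_cont : continuous_wrt (@G_open F) (@G_open E) g).
Hypothesis fM : forall a b c, gprod a b c -> gprod (f a) (f b) (f c).
Hypothesis gM : forall a b c, gprod a b c -> gprod (g a) (g b) (g c).

(** Conjugation by the unit map corresponds to moving the bisection along [f], that is, to taking
    its preimage under [g]. *)
Lemma transport_full_group h : in_full_group h ->
  in_full_group (unit_map f \o h \o unit_map g).
Proof.
move=> [U [[oU [Us [Ur [ty tx]]]] [hU cK]]].
have ufK := unit_mapK fK fM; have ugK := unit_mapK gK gM.
exists (fun b => U (g b)); split; [split; [|split; [|split; [|split]]]|split].
- exact: g_cont oU.
- move=> b b' Ub Ub' e; apply: (can_inj gK); apply: Us => //.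
  by rewrite !(gy_unit_map gM) e.
- move=> b b' Ub Ub' e; apply: (can_inj gK); apply: Ur => //.
  by rewrite !(gx_unit_map gM) e.
- move=> y; have [a [Ua ay]] := ty (unit_map g y).
  by exists (f a); rewrite fK (gy_unit_map fM) ay ugK.
- move=> x; have [a [Ua ax]] := tx (unit_map g x).
  by exists (f a); rewrite fK (gx_unit_map fM) ax ugK.
- move=> b Ub; rewrite /= -(gy_unit_map gM) hU //.
  by rewrite (gx_unit_map gM) ugK.
move=> I O oO cov.
have [i|x cx|s sP] := cK I (fun i x => O i (unit_map f x)).
- exact: (unit_map_continuous f_cont (@oO i)).
- apply: cov => A oA Ax.
  have [z [Az mz]] := cx _ (unit_map_continuous f_cont oA) Ax.
  by exists (unit_map f z); split=> //= e; apply: mz; move: e; rewrite ufK => /(can_inj ufK).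
exists s => y cy; rewrite -(ugK y); apply: sP => A oA Ay.
have [z [Az mz]] := cy _ (unit_map_continuous g_cont oA) Ay.
by exists (unit_map g z); split=> //= e; apply: mz; rewrite /= e ugK.
Qed.

End TransportFullGroup.

Lemma grpd_iso_full_iso (E F : graph) : grpd_iso E F -> full_group_iso E F.
Proof.
move=> [f [g [fK [gK [fc [gc fgM]]]]]].
have fM a b c : gprod a b c -> gprod (f a) (f b) (f c) by move=> /fgM.
have gM a b c : gprod a b c -> gprod (g a) (g b) (g c).
  by move=> abc; apply/fgM; rewrite !gK.
have ufK := unit_mapK fK fM; have ugK := unit_mapK gK gM.
pose phi (h : full_group E) : full_group F :=
  exist _ _ (transport_full_group fK gK fc gc fM gM (svalP h)).
pose psi (h : full_group F) : full_group E :=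
  exist _ _ (transport_full_group gK fK gc fc gM fM (svalP h)).
exists phi; split.
  exists psi => h; apply: full_group_ext => x /=; first by rewrite !ufK.
  by rewrite !ugK.
by move=> h1 h2 k kE; apply: functional_extensionality => y /=; rewrite kE /= ufK.
Qed.

Theorem theorem10p11 (E F : graph) :
  condL E -> condT E -> no_degenerate E ->
  condL F -> condT F -> no_degenerate F ->
  (grpd_iso E F <-> full_group_iso E F).
Proof.
move=> EL ET EN FL FT FN; split; first exact: grpd_iso_full_iso.
exact: full_iso_grpd_iso.
Qed.
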